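(* Let $G$ be a connected, finite (in particular locally finite) graph. Then the type $\mathsf{Planar}(G) :\equiv \sum_{\mathcal{M} : \mathsf{Map}(G)} \mathsf{Spherical}(\mathcal{M}) \times \mathsf{Face}(G,\mathcal{M})$ of planar maps of $G$ is a set.
   Context: Work in homotopy type theory with a univalent universe $\mathcal{U}$, function extensionality and propositional truncation $\|-\|$. A graph $G$: a set $N_G$ and a set-valued family $E_G:N_G\to N_G\to\mathcal{U}$; finite if $N_G$ and all $E_G(x,y)$ are finite types; connected if a walk merely exists between any two nodes; locally finite if every star $\mathsf{Star}_G(x)$ is finite. Homomorphisms $(\alpha,\beta):G\to H$: $\alpha:N_G\to N_H$, $\beta:\prod_{x,y}E_G(x,y)\to E_H(\alpha x,\alpha y)$. $[n]=\{0,\dots,n-1\}$, $\mathsf{pred}:0\mapsto n-1$, $i+1\mapsto i$. Cycle graph $C_n$ ($n\ge1$): nodes $[n]$, $E(u,v):\equiv(u=\mathsf{pred}\,v)$; $C_0$ the one-point graph; $\mathsf{rot}:\mathsf{Hom}(C_n,C_n)$ acts by $\mathsf{pred}$ on nodes. A cyclic graph is a graph $A$ with $\varphi:\mathsf{Hom}(A,A)$, $n:\mathbb{N}$ and a witness of $\|(A,\varphi)=(C_n,\mathsf{rot})\|$; $\mathsf{pred}_A,\mathsf{suc}_A$ are the node map of $\varphi$ and its inverse. Symmetrisation $U(G)$: nodes $N_G$, $E_{U(G)}(x,y):\equiv E_G(x,y)+E_G(y,x)$; $\mathsf{flip}$ swaps $\mathsf{inl}/\mathsf{inr}$, reversing an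 edge. $\mathsf{Star}_G(x):\equiv\sum_{y}E_{U(G)}(x,y)$. $\mathsf{Cyclic}(X):\equiv\sum_{\varphi:X\to X}\sum_{n}\|\sum_{e:X\simeq[n]}e\circ\varphi=\mathsf{pred}\circ e\|$; $\mathsf{Map}(G):\equiv\prod_{x}\mathsf{Cyclic}(\mathsf{Star}_G(x))$; $\mathcal{M}(x)\langle s\rangle$ applies the function of $\mathcal{M}(x)$ to $s$. A homomorphism is edge-injective if its induced map on total edge types $\sum_{x,y}E(x,y)$ is an embedding. $\mathsf{Face}(G,\mathcal{M})$: tuples of a cyclic graph $A$, $h=(\alpha,\beta):\mathsf{Hom}(A,U(G))$ edge-injective, star-compatible ($\prod_{x:N_A}\|\mathsf{Star}_G(\alpha x)\|\to\|\mathsf{Star}_A(x)\|$) and corner-compatible (for all $x:N_A$, with $a$ the edge $\mathsf{pred}_A x\to x$ and $a^+$ the edge $x\to\mathsf{suc}_A x$ of $A$: $\mathcal{M}(\alpha x)\langle(\alpha(\mathsf{pred}_A x),\mathsf{flip}(\beta(\mathsf{pred}_A x,x,a)))\rangle=(\alpha(\mathsf{suc}_A x),\beta(x,\mathsf{suc}_A x,a^+))$). Walks $\mathsf{Walk}_H(x,y)$: trivial $\langle x\rangle$ or $e\odot w$ with $e:E_H(x,z)$, $w:\mathsf{Walk}_H(z,y)$; $\cdot$ concatenation. For a face $\mathcal{F}$ and nodes $a,b$ of $A$: $\mathsf{cw}_{\mathcal{F}}(a,b)$ is the $h$-image of the walk in $U(A)$ from $a$ to $b$ along edges $x\to\mathsf{suc}_A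 x$ (once around if $a=b$); $\mathsf{ccw}_{\mathcal{F}}(a,b)$ the $h$-image of the walk along reversed edges $x\to\mathsf{pred}_A x$ (trivial if $a=b$). Walk-homotopy $\sim_{\mathcal{M}}$ on $\mathsf{Walk}_{U(G)}(x,y)$ is generated by reflexivity, symmetry, transitivity and $\mathsf{hcollapse}$: $(w_1\cdot\mathsf{ccw}_{\mathcal{F}}(a,b)\cdot w_2)\sim_{\mathcal{M}}(w_1\cdot\mathsf{cw}_{\mathcal{F}}(a,b)\cdot w_2)$ for any face $\mathcal{F}$, $w_1:\mathsf{Walk}_{U(G)}(x,\alpha a)$, $w_2:\mathsf{Walk}_{U(G)}(\alpha b,y)$. $\mathsf{Spherical}(\mathcal{M}):\equiv\prod_{x,y}\prod_{w_1,w_2:\mathsf{Walk}_{U(G)}(x,y)}\|w_1\sim_{\mathcal{M}}w_2\|$. *)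

(* Defs.v *)
From Stdlib Require Import List Arith.

(** Univalence contradicts uniqueness of identity proofs, so homotopy type
    theory is not modelled here by Rocq's own types: the statement would then
    follow from (or be inconsistent with) proof irrelevance and similar axioms.
    Instead homotopy type theory is a formal system, set up as in Appendix A.1
    of the HoTT Book: a dependent lambda calculus with a cumulative hierarchy
    of universes, constants given by their types and by computation rules, and
    a definitional equality on raw terms.  A theorem of homotopy type theory is
    a closed type with a derivable inhabitant. *)

(** * Raw terms (de Bruijn indices) *)

(** [EqvR X R] is the inductive family on [X] generated by [R], reflexivity,
    symmetry and transitivity.  It is a type of derivations, not truncated. *)
Inductive const : Set :=
| cZero | cIndZero
| cOne | cTt | cIndOne
| cSum | cInl | cInr | cIndSum
| cSigma | cPair | cIndSigma
| cNat | cO | cS | cIndNat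
| cId | cRefl | cJ
| cTrunc | cTr | cTrPath | cTrRec
| cWalk | cNil | cCons | cIndWalk
| cEqvR | cEqvIncl | cEqvRefl | cEqvSym | cEqvTrans | cIndEqvR
| cFunext | cUnivalence.

Inductive tm : Set :=
| Var (n : nat)
| Univ (i : nat)
| Pi (A B : tm)
| Lam (A t : tm)
| App (t u : tm)
| Const (c : const).

Fixpoint shift (k : nat) (t : tm) : tm :=
  match t with
  | Var n => if k <=? n then Var (S n) else Var n
  | Univ i => Univ i
  | Pi A B => Pi (shift k A) (shift (S k) B)
  | Lam A t => Lam (shift k A) (shift (S k) t)
  | App t u => App (shift k t) (shift k u)
  | Const c => Const c
  end.

Fixpoint subst (k : nat) (u t : tm) : tm :=
  match t with
  | Var n => if n =? k then u else if k <? n then Var (pred n) else Var n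
  | Univ i => Univ i
  | Pi A B => Pi (subst k u A) (subst (S k) (shift 0 u) B)
  | Lam A t => Lam (subst k u A) (subst (S k) (shift 0 u) t)
  | App t v => App (subst k u t) (subst k u v)
  | Const c => Const c
  end.

(** * Definitional equality *)

Local Notation "f · a" := (App f a) (at level 11, left associativity).
Local Coercion Const : const >-> tm.

Inductive iota : tm -> tm -> Prop :=
| iota_One C c :
    iota (cIndOne · C · c · cTt) c
| iota_inl A B C f g a :
    iota (cIndSum · A · B · C · f · g · (cInl · A · B · a)) (f · a)
| iota_inr A B C f g b :
    iota (cIndSum · A · B · C · f · g · (cInr · A · B · b)) (g · b)
| iota_pair A B C f a b :
    iota (cIndSigma · A · B · C · f · (cPair · A · B · a · b)) (f · a · b)
| iota_O C z s :
    iota (cIndNat · C · z · s · cO) z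
| iota_S C z s n :
    iota (cIndNat · C · z · s · (cS · n))
         (s · n · (cIndNat · C · z · s · n))
| iota_refl A a C d :
    iota (cJ · A · a · C · d · a · (cRefl · A · a)) d
| iota_tr A P h f a :
    iota (cTrRec · A · P · h · f · (cTr · A · a)) (f · a)
| iota_nil N E C b s x :
    iota (cIndWalk · N · E · C · b · s · x · x · (cNil · N · E · x)) (b · x)
| iota_cons N E C b s x y z e w :
    iota (cIndWalk · N · E · C · b · s · x · z
            · (cCons · N · E · x · y · z · e · w))
         (s · x · y · z · e · w · (cIndWalk · N · E · C · b · s · y · z · w))
| iota_EqvIncl X R C ci cr cs ct x y r :
    iota (cIndEqvR · X · R · C · ci · cr · cs · ct · x · y
            · (cEqvIncl · X · R · x · y · r))
         (ci · x · y · r)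
| iota_EqvRefl X R C ci cr cs ct x :
    iota (cIndEqvR · X · R · C · ci · cr · cs · ct · x · x
            · (cEqvRefl · X · R · x))
         (cr · x)
| iota_EqvSym X R C ci cr cs ct x y p :
    iota (cIndEqvR · X · R · C · ci · cr · cs · ct · y · x
            · (cEqvSym · X · R · x · y · p))
         (cs · x · y · p
            · (cIndEqvR · X · R · C · ci · cr · cs · ct · x · y · p))
| iota_EqvTrans X R C ci cr cs ct x y z p q :
    iota (cIndEqvR · X · R · C · ci · cr · cs · ct · x · z
            · (cEqvTrans · X · R · x · y · z · p · q))
         (ct · x · y · z · p · q
            · (cIndEqvR · X · R · C · ci · cr · cs · ct · x · y · p)
            · (cIndEqvR · X · R · C · ci · cr · cs · ct · y · z · q)).

Inductive defeq : tm -> tm -> Prop :=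
| defeq_refl t : defeq t t
| defeq_sym t u : defeq t u -> defeq u t
| defeq_trans t u v : defeq t u -> defeq u v -> defeq t v
| defeq_Pi A A' B B' :
    defeq A A' -> defeq B B' -> defeq (Pi A B) (Pi A' B')
| defeq_Lam A A' t t' :
    defeq A A' -> defeq t t' -> defeq (Lam A t) (Lam A' t')
| defeq_App t t' u u' :
    defeq t t' -> defeq u u' -> defeq (App t u) (App t' u')
| defeq_beta A t u : defeq (App (Lam A t) u) (subst 0 u t)
| defeq_eta A t : defeq (Lam A (App (shift 0 t) (Var 0))) t
| defeq_iota t u : iota t u -> defeq t u.

(** * Notation for terms with named binders *)

(** An expression is a term as a function of the number of enclosing binders;
    a bound variable is known by its de Bruijn level, which makes weakening
    invisible.  Thus binders of the object language are Rocq functions. *)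
Record exp := Exp { tm_at : nat -> tm }.

Definition closed (e : exp) : tm := tm_at e 0.

Definition evar (level : nat) : exp := Exp (fun d => Var (d - S level)).
Definition epi (A : exp) (B : exp -> exp) : exp :=
  Exp (fun d => Pi (tm_at A d) (tm_at (B (evar d)) (S d))).
Definition elam (A : exp) (t : exp -> exp) : exp :=
  Exp (fun d => Lam (tm_at A d) (tm_at (t (evar d)) (S d))).
Definition eapp (t u : exp) : exp := Exp (fun d => App (tm_at t d) (tm_at u d)).
Definition econst (c : const) : exp := Exp (fun _ => Const c).
Definition U (i : nat) : exp := Exp (fun _ => Univ i).

Coercion eapp : exp >-> Funclass.

Declare Scope hott_scope.
Delimit Scope hott_scope with hott.
Bind Scope hott_scope with exp.
Open Scope hott_scope.

Notation "'Π' x : A , B" := (epi A (fun x : exp => B))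
  (at level 200, x name, A at level 99, B at level 200) : hott_scope.
Notation "'λ' x : A , t" := (elam A (fun x : exp => t))
  (at level 200, x name, A at level 99, t at level 200) : hott_scope.
Notation "A ⇒ B" := (epi A (fun _ : exp => B))
  (at level 98, right associativity) : hott_scope.

Definition Zero := econst cZero.
Definition indZero := econst cIndZero.
Definition One := econst cOne.
Definition tt := econst cTt.
Definition indOne := econst cIndOne.
Definition Sum := econst cSum.
Definition inl := econst cInl.
Definition inr := econst cInr.
Definition indSum := econst cIndSum.
Definition Sigma := econst cSigma.
Definition cpair := econst cPair.
Definition indSigma := econst cIndSigma.
Definition Nat := econst cNat.
Definition zero := econst cO.
Definition succ := econst cS.
Definition indNat := econst cIndNat.
Definition Id := econst cId.
Definition refl := econst cRefl.
Definition J := econst cJ.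
Definition Trunc := econst cTrunc.
Definition tr := econst cTr.
Definition trPath := econst cTrPath.
Definition trRec := econst cTrRec.
Definition Walk := econst cWalk.
Definition nil := econst cNil.
Definition cons := econst cCons.
Definition indWalk := econst cIndWalk.
Definition EqvR := econst cEqvR.
Definition eqvIncl := econst cEqvIncl.
Definition eqvRefl := econst cEqvRefl.
Definition eqvSym := econst cEqvSym.
Definition eqvTrans := econst cEqvTrans.
Definition indEqvR := econst cIndEqvR.

(** Σ-types remember their two components in Rocq, so that pairs and
    projections need not repeat them. *)
Record sigma := Sig { dom : exp; fam : exp -> exp }.

Definition famL (T : sigma) : exp := λ x : dom T, fam T x.
Definition sigma_type (T : sigma) : exp := Sigma (dom T) (famL T).
Coercion sigma_type : sigma >-> exp.

Notation "'Σ' x : A , B" := (Sig A (fun x : exp => B))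
  (at level 200, x name, A at level 99, B at level 200) : hott_scope.
Notation "A × B" := (Sig A (fun _ : exp => B))
  (at level 97, right associativity) : hott_scope.

Definition pair (T : sigma) (a b : exp) : exp := cpair (dom T) (famL T) a b.
Definition pr1 (T : sigma) (p : exp) : exp :=
  indSigma (dom T) (famL T) (λ _ : T, dom T)
    (λ x : dom T, λ _ : fam T x, x) p.
Definition pr2 (T : sigma) (p : exp) : exp :=
  indSigma (dom T) (famL T) (λ q : T, fam T (pr1 T q))
    (λ x : dom T, λ y : fam T x, y) p.
Definition recSigma (T : sigma) (C : exp) (f : exp -> exp -> exp) (p : exp)
    : exp :=
  indSigma (dom T) (famL T) (λ _ : T, C) (λ x : dom T, λ y : fam T x, f x y) p.

(** * Basic homotopy type theory *)

Definition isContr (A : exp) : sigma := Σ x : A, Π y : A, Id A x y.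
Definition isProp (A : exp) : exp := Π x : A, Π y : A, Id A x y.
Definition isSet (A : exp) : exp := Π x : A, Π y : A, isProp (Id A x y).

Definition fiber (A B f y : exp) : sigma := Σ x : A, Id B (f x) y.
Definition isEquiv (A B f : exp) : exp := Π y : B, isContr (fiber A B f y).
Definition Equiv (A B : exp) : sigma := Σ f : A ⇒ B, isEquiv A B f.

Definition idEquiv (A : exp) : exp :=
  pair (Equiv A A) (λ x : A, x)
    (λ y : A,
      let F := fiber A A (λ x : A, x) in
      pair (isContr (F y)) (pair (F y) y (refl A y))
        (λ q : F y,
          indSigma A (famL (F y))
            (λ q : F y, Id (F y) (pair (F y) y (refl A y)) q)
            (λ x : A, λ p : Id A x y,
              J A x
                (λ y : A, λ p : Id A x y,
                  Id (F y) (pair (F y) y (refl A y)) (pair (F y) x p))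
                (refl (F x) (pair (F x) x (refl A x)))
                y p)
            q)).

Definition idtoeqv (i : nat) (A B : exp) : exp :=
  λ p : Id (U i) A B,
    J (U i) A (λ B : U i, λ _ : Id (U i) A B, Equiv A B) (idEquiv A) B p.

Definition happly (A B f g : exp) : exp :=
  let F := Π x : A, B x in
  λ p : Id F f g,
    J F f (λ g : F, λ _ : Id F f g, Π x : A, Id (B x) (f x) (g x))
      (λ x : A, refl (B x) (f x)) g p.

Definition ap (A B f x y : exp) : exp :=
  λ p : Id A x y,
    J A x (λ y : A, λ _ : Id A x y, Id B (f x) (f y)) (refl B (f x)) y p.

Definition isEmbedding (A B f : exp) : exp :=
  Π x : A, Π y : A, isEquiv (Id A x y) (Id B (f x) (f y)) (ap A B f x y).

(** * Types of the constants *)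

(** The levels [i] and [j] are implicit in terms: a constant has the type below
    for all levels. *)
Definition const_type (c : const) (i j : nat) : exp :=
  match c with
  | cZero => U i
  | cIndZero => Π C : Zero ⇒ U j, Π x : Zero, C x
  | cOne => U i
  | cTt => One
  | cIndOne => Π C : One ⇒ U j, C tt ⇒ Π x : One, C x
  | cSum => U i ⇒ U i ⇒ U i
  | cInl => Π A : U i, Π B : U i, A ⇒ Sum A B
  | cInr => Π A : U i, Π B : U i, B ⇒ Sum A B
  | cIndSum =>
      Π A : U i, Π B : U i, Π C : Sum A B ⇒ U j,
      (Π a : A, C (inl A B a)) ⇒ (Π b : B, C (inr A B b)) ⇒
      Π x : Sum A B, C x
  | cSigma => Π A : U i, (A ⇒ U i) ⇒ U i
  | cPair => Π A : U i, Π B : A ⇒ U i, Π a : A, B a ⇒ Sigma A B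
  | cIndSigma =>
      Π A : U i, Π B : A ⇒ U i, Π C : Sigma A B ⇒ U j,
      (Π a : A, Π b : B a, C (cpair A B a b)) ⇒ Π x : Sigma A B, C x
  | cNat => U i
  | cO => Nat
  | cS => Nat ⇒ Nat
  | cIndNat =>
      Π C : Nat ⇒ U j, C zero ⇒ (Π n : Nat, C n ⇒ C (succ n)) ⇒
      Π n : Nat, C n
  | cId => Π A : U i, A ⇒ A ⇒ U i
  | cRefl => Π A : U i, Π a : A, Id A a a
  | cJ =>
      Π A : U i, Π a : A, Π C : (Π b : A, Id A a b ⇒ U j),
      C a (refl A a) ⇒ Π b : A, Π p : Id A a b, C b p
  | cTrunc => U i ⇒ U i
  | cTr => Π A : U i, A ⇒ Trunc A
  | cTrPath => Π A : U i, isProp (Trunc A)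
  | cTrRec =>
      Π A : U i, Π P : U j, isProp P ⇒ (A ⇒ P) ⇒ Trunc A ⇒ P
  | cWalk => Π N : U i, (N ⇒ N ⇒ U i) ⇒ N ⇒ N ⇒ U i
  | cNil => Π N : U i, Π E : N ⇒ N ⇒ U i, Π x : N, Walk N E x x
  | cCons =>
      Π N : U i, Π E : N ⇒ N ⇒ U i, Π x : N, Π y : N, Π z : N,
      E x y ⇒ Walk N E y z ⇒ Walk N E x z
  | cIndWalk =>
      Π N : U i, Π E : N ⇒ N ⇒ U i,
      Π C : (Π x : N, Π y : N, Walk N E x y ⇒ U j),
      (Π x : N, C x x (nil N E x)) ⇒
      (Π x : N, Π y : N, Π z : N, Π e : E x y, Π w : Walk N E y z,
        C y z w ⇒ C x z (cons N E x y z e w)) ⇒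
      Π x : N, Π y : N, Π w : Walk N E x y, C x y w
  | cEqvR => Π X : U i, (X ⇒ X ⇒ U i) ⇒ X ⇒ X ⇒ U i
  | cEqvIncl =>
      Π X : U i, Π R : X ⇒ X ⇒ U i, Π x : X, Π y : X,
      R x y ⇒ EqvR X R x y
  | cEqvRefl => Π X : U i, Π R : X ⇒ X ⇒ U i, Π x : X, EqvR X R x x
  | cEqvSym =>
      Π X : U i, Π R : X ⇒ X ⇒ U i, Π x : X, Π y : X,
      EqvR X R x y ⇒ EqvR X R y x
  | cEqvTrans =>
      Π X : U i, Π R : X ⇒ X ⇒ U i, Π x : X, Π y : X, Π z : X,
      EqvR X R x y ⇒ EqvR X R y z ⇒ EqvR X R x z
  | cIndEqvR =>
      Π X : U i, Π R : X ⇒ X ⇒ U i,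
      Π C : (Π x : X, Π y : X, EqvR X R x y ⇒ U j),
      (Π x : X, Π y : X, Π r : R x y, C x y (eqvIncl X R x y r)) ⇒
      (Π x : X, C x x (eqvRefl X R x)) ⇒
      (Π x : X, Π y : X, Π p : EqvR X R x y,
        C x y p ⇒ C y x (eqvSym X R x y p)) ⇒
      (Π x : X, Π y : X, Π z : X, Π p : EqvR X R x y, Π q : EqvR X R y z,
        C x y p ⇒ C y z q ⇒ C x z (eqvTrans X R x y z p q)) ⇒
      Π x : X, Π y : X, Π p : EqvR X R x y, C x y p
  | cFunext =>
      Π A : U i, Π B : A ⇒ U i, Π f : (Π x : A, B x), Π g : (Π x : A, B x),
      isEquiv (Id (Π x : A, B x) f g) (Π x : A, Id (B x) (f x) (g x))
        (happly A B f g)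
  | cUnivalence =>
      Π A : U i, Π B : U i,
      isEquiv (Id (U i) A B) (Equiv A B) (idtoeqv i A B)
  end.

(** * Typing *)

Inductive wf : list tm -> Prop :=
| wf_nil : wf List.nil
| wf_cons Γ A i : typed Γ A (Univ i) -> wf (List.cons A Γ)

with typed : list tm -> tm -> tm -> Prop :=
| typed_Var Γ A n :
    wf Γ -> nth_error Γ n = Some A ->
    typed Γ (Var n) (Nat.iter (S n) (shift 0) A)
| typed_Univ Γ i : wf Γ -> typed Γ (Univ i) (Univ (S i))
| typed_cumul Γ A i : typed Γ A (Univ i) -> typed Γ A (Univ (S i))
| typed_Pi Γ A B i :
    typed Γ A (Univ i) -> typed (List.cons A Γ) B (Univ i) ->
    typed Γ (Pi A B) (Univ i)
| typed_Lam Γ A B t :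
    typed (List.cons A Γ) t B -> typed Γ (Lam A t) (Pi A B)
| typed_App Γ A B t u :
    typed Γ t (Pi A B) -> typed Γ u A -> typed Γ (App t u) (subst 0 u B)
| typed_Const Γ c i j : wf Γ -> typed Γ (Const c) (closed (const_type c i j))
| typed_conv Γ A B t i :
    typed Γ t A -> defeq A B -> typed Γ B (Univ i) -> typed Γ t B.

Definition Derivable (A : exp) : Prop :=
  exists t : tm, typed List.nil t (closed A).

(** * Finite types *)

Definition plus (m n : exp) : exp :=
  indNat (λ _ : Nat, Nat) n (λ _ : Nat, λ r : Nat, succ r) m.
Definition lt (m n : exp) : sigma := Σ k : Nat, Id Nat (succ (plus m k)) n.
Definition not (A : exp) : exp := A ⇒ Zero.

(** [Fin n] is [{0, ..., n-1}]: in [Fin (succ n)], which is [One + Fin n],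
    [inl tt] is 0 and [inr i] is [i + 1]. *)
Definition Fin (n : exp) : exp :=
  indNat (λ _ : Nat, U 0) Zero (λ _ : Nat, λ X : U 0, Sum One X) n.
Definition fin0 (n : exp) : exp := inl One (Fin n) tt.
Definition finS (n i : exp) : exp := inr One (Fin n) i.

Definition finLast (n : exp) : exp :=
  indNat (λ n : Nat, Fin (succ n)) (fin0 zero)
    (λ n : Nat, λ r : Fin (succ n), finS (succ n) r) n.

(** The inclusion of [Fin n] in [Fin (succ n)] that preserves values. *)
Definition finWiden (n : exp) : exp :=
  indNat (λ n : Nat, Fin n ⇒ Fin (succ n))
    (λ x : Fin zero, indZero (λ _ : Zero, Fin (succ zero)) x)
    (λ n : Nat, λ r : Fin n ⇒ Fin (succ n), λ x : Fin (succ n),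
      indSum One (Fin n) (λ _ : Fin (succ n), Fin (succ (succ n)))
        (λ _ : One, fin0 (succ n))
        (λ i : Fin n, finS (succ n) (r i))
        x)
    n.

Definition finPred (n : exp) : exp :=
  indNat (λ n : Nat, Fin n ⇒ Fin n)
    (λ x : Fin zero, x)
    (λ n : Nat, λ _ : Fin n ⇒ Fin n, λ x : Fin (succ n),
      indSum One (Fin n) (λ _ : Fin (succ n), Fin (succ n))
        (λ _ : One, finLast n)
        (λ i : Fin n, finWiden n i)
        x)
    n.

Definition isFinite (X : exp) : sigma := Σ n : Nat, Trunc (Equiv X (Fin n)).

(** * Graphs *)

(** A graph is quantified over by quantifying over its components.  In Rocq
    its nodes and edges are kept together as a pair of expressions, leaving out
    the proofs that they form sets.  The univalent universe in which graphs
    live is [U 0]. *)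
Record graph := MkGraph { node : exp; edge : exp -> exp -> exp }.

Definition isGraph (G : graph) : sigma :=
  isSet (node G) × (Π x : node G, Π y : node G, isSet (edge G x y)).

Definition ΠGraph (k : graph -> exp) : exp :=
  Π N : U 0, Π E : N ⇒ N ⇒ U 0,
  isGraph (MkGraph N (fun x y => E x y)) ⇒ k (MkGraph N (fun x y => E x y)).

(** Homomorphisms are the elements [(α, β)] of
    [Σ α : HomNodes G H, HomEdges G H α]. *)
Definition HomNodes (G H : graph) : exp := node G ⇒ node H.
Definition HomEdges (G H : graph) (α : exp) : exp :=
  Π x : node G, Π y : node G, edge G x y ⇒ edge H (α x) (α y).

Definition symm (G : graph) : graph :=
  MkGraph (node G) (fun x y => Sum (edge G x y) (edge G y x)).

Definition flip (G : graph) (x y e : exp) : exp :=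
  indSum (edge G x y) (edge G y x)
    (λ _ : edge (symm G) x y, edge (symm G) y x)
    (λ e : edge G x y, inr (edge G y x) (edge G x y) e)
    (λ e : edge G y x, inl (edge G y x) (edge G x y) e)
    e.

Definition Star (G : graph) (x : exp) : sigma :=
  Σ y : node G, edge (symm G) x y.

Definition edgeL (G : graph) : exp := λ x : node G, λ y : node G, edge G x y.
Definition WalkIn (G : graph) (x y : exp) : exp := Walk (node G) (edgeL G) x y.
Definition nilIn (G : graph) (x : exp) : exp := nil (node G) (edgeL G) x.
Definition consIn (G : graph) (x y z e w : exp) : exp :=
  cons (node G) (edgeL G) x y z e w.

Definition concat (G : graph) (x y z w w' : exp) : exp :=
  indWalk (node G) (edgeL G)
    (λ x : node G, λ y : node G, λ _ : WalkIn G x y,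
      WalkIn G y z ⇒ WalkIn G x z)
    (λ x : node G, λ w' : WalkIn G x z, w')
    (λ x : node G, λ u : node G, λ y : node G,
     λ e : edge G x u, λ _ : WalkIn G u y,
     λ r : WalkIn G y z ⇒ WalkIn G u z, λ w' : WalkIn G y z,
      consIn G x u z e (r w'))
    x y w w'.

Definition Connected (G : graph) : exp :=
  Π x : node G, Π y : node G, Trunc (WalkIn G x y).

Definition FiniteGraph (G : graph) : sigma :=
  isFinite (node G) ×
  (Π x : node G, Π y : node G, isFinite (edge G x y)).

(** * Cyclic graphs *)

(** [GraphEndo] is the type of graphs together with an endomorphism. *)
Definition GraphEndo4 (G : graph) (α : exp) : exp := HomEdges G G α.
Definition GraphEndo3 (G : graph) : sigma :=
  Σ α : HomNodes G G, GraphEndo4 G α.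
Definition GraphEndo2 (G : graph) : sigma := isGraph G × GraphEndo3 G.
Definition GraphEndo1 (N : exp) : sigma :=
  Σ E : N ⇒ N ⇒ U 0, GraphEndo2 (MkGraph N (fun x y => E x y)).
Definition GraphEndo : sigma := Σ N : U 0, GraphEndo1 N.

Definition graphEndo (G : graph) (p α β : exp) : exp :=
  pair GraphEndo (node G)
    (pair (GraphEndo1 (node G)) (edgeL G)
      (pair (GraphEndo2 G) p (pair (GraphEndo3 G) α β))).

(** The cycle graph [C_0] and its endomorphism [rot]. *)
Definition cycle0 : graph := MkGraph One (fun _ _ => Zero).
Definition rot0Nodes : exp := λ x : One, x.
Definition rot0Edges : exp := λ _ : One, λ _ : One, λ e : Zero, e.

(** The cycle graph [C_n] and its endomorphism [rot], for positive [n]. *)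
Definition cycle (n : exp) : graph :=
  MkGraph (Fin n) (fun u v => Id (Fin n) u (finPred n v)).
Definition rotNodes (n : exp) : exp := finPred n.
Definition rotEdges (n : exp) : exp :=
  λ u : Fin n, λ v : Fin n, ap (Fin n) (Fin n) (finPred n) u (finPred n v).

(** The truncated identification of [(A, φ)], where [φ] is [(α, β)], with
    [(C_n, rot)], by cases on [n].  To be an element of the type of graphs,
    [C_n] takes a proof [p] that its nodes and edges form sets; the type of such
    proofs is an inhabited proposition, so [Σ p] only supplies the proof. *)
Definition IsCycle (A : graph) (s α β n : exp) : exp :=
  let same C rn re :=
    Trunc (Σ p : isGraph C,
      Id GraphEndo (graphEndo A s α β) (graphEndo C p rn re)) in
  indNat (λ _ : Nat, U 1)
    (same cycle0 rot0Nodes rot0Edges)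
    (λ m : Nat, λ _ : U 1,
      same (cycle (succ m)) (rotNodes (succ m)) (rotEdges (succ m)))
    n.

(** The function [pred] of a cyclic graph is a bijection of a set, so that the
    type of its two-sided inverses [suc] is contractible; [ΣCyclic] adjoins the
    inverse to the components of a cyclic graph. *)
Record cyclic := MkCyclic
  { cgraph :> graph; cpred : exp; csuc : exp; csize : exp }.

Definition ΣCyclic (k : cyclic -> exp) : exp :=
  Σ N : U 0, Σ E : N ⇒ N ⇒ U 0,
  let A := MkGraph N (fun x y => E x y) in
  Σ s : isGraph A, Σ α : HomNodes A A, Σ β : HomEdges A A α,
  Σ n : Nat, IsCycle A s α β n ×
  (Σ suc : N ⇒ N,
    (Π x : N, Id N (suc (α x)) x) × (Π x : N, Id N (α (suc x)) x) ×
    k (MkCyclic A α suc n)).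

(** * Maps *)

Definition CyclicWith (X φ : exp) : sigma :=
  Σ n : Nat,
  Trunc
    (Σ e : Equiv X (Fin n),
      let f := pr1 (Equiv X (Fin n)) e in
      Id (X ⇒ Fin n) (λ x : X, f (φ x)) (λ x : X, finPred n (f x))).
Definition Cyclic (X : exp) : sigma := Σ φ : X ⇒ X, CyclicWith X φ.

Definition Map (G : graph) : exp := Π x : node G, Cyclic (Star G x).
Definition rotate (G : graph) (M x s : exp) : exp :=
  pr1 (Cyclic (Star G x)) (M x) s.

(** * Faces *)

Definition EdgesFrom (G : graph) (x : exp) : sigma :=
  Σ y : node G, edge G x y.
Definition TotalEdges (G : graph) : sigma := Σ x : node G, EdgesFrom G x.
Definition onTotalEdges (G H : graph) (α β : exp) : exp :=
  λ t : TotalEdges G,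
    recSigma (TotalEdges G) (TotalEdges H)
      (fun x u =>
        recSigma (EdgesFrom G x) (TotalEdges H)
          (fun y e =>
            pair (TotalEdges H) (α x)
              (pair (EdgesFrom H (α x)) (α y) (β x y e)))
          u)
      t.
Definition EdgeInjective (G H : graph) (α β : exp) : exp :=
  isEmbedding (TotalEdges G) (TotalEdges H) (onTotalEdges G H α β).

Definition StarCompatible (G A : graph) (α : exp) : exp :=
  Π x : node A, Trunc (Star G (α x)) ⇒ Trunc (Star A x).

(** For a positive number of nodes the edges [a] and [a'] exist and are unique;
    [C_0] has no edges and the condition is void. *)
Definition CornerCompatible (G : graph) (M : exp) (A : cyclic) (α β : exp)
    : exp :=
  let pred := cpred A in
  let suc := csuc A in
  Π x : node A, Π a : edge A (pred x) x, Π a' : edge A x (suc x),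
    Id (Star G (α x))
      (rotate G M (α x)
        (pair (Star G (α x)) (α (pred x))
          (flip G (α (pred x)) (α x) (β (pred x) x a))))
      (pair (Star G (α x)) (α (suc x)) (β x (suc x) a')).

Definition IsFace (G : graph) (M : exp) (A : cyclic) (α β : exp) : sigma :=
  EdgeInjective A (symm G) α β ×
  StarCompatible G A α × CornerCompatible G M A α β.

(** [ΣFace G M k] is the sum of [k] over all faces, as an iterated sum over
    the components of a face. *)
Definition ΣFace (G : graph) (M : exp) (k : cyclic -> exp -> exp -> exp)
    : exp :=
  ΣCyclic (fun A =>
    Σ α : HomNodes A (symm G), Σ β : HomEdges A (symm G) α,
    IsFace G M A α β × k A α β).

Definition Face (G : graph) (M : exp) : exp :=
  ΣCyclic (fun A =>
    Σ α : HomNodes A (symm G), Σ β : HomEdges A (symm G) α,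
    IsFace G M A α β).

(** * The two walks along a face *)

(** [Steps G f E k a b] is the type of walks of length [k] from [a] to [b] along
    edges [x -> f x] taken from the types [E x], by recursion on [k]. *)
Definition Steps (G : graph) (f : exp) (E : exp -> exp) (k a b : exp) : exp :=
  let N := node G in
  indNat (λ _ : Nat, N ⇒ N ⇒ U 0)
    (λ a : N, λ b : N, Id N a b)
    (λ _ : Nat, λ r : N ⇒ N ⇒ U 0, λ a : N, λ b : N, E a × r (f a) b)
    k a b.

(** The corresponding walk in [symm G], where [i x] maps [E x] to the edges
    from [x] to [f x] in [symm G]. *)
Definition stepsWalk (G : graph) (f : exp) (E : exp -> exp)
    (i : exp -> exp -> exp) (k a b q : exp) : exp :=
  let N := node G in
  let W a b := WalkIn (symm G) a b in
  let T k a b := Steps G f E k a b in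
  indNat (λ k : Nat, Π a : N, Π b : N, T k a b ⇒ W a b)
    (λ a : N, λ b : N, λ p : Id N a b,
      J N a (λ b : N, λ _ : Id N a b, W a b) (nilIn (symm G) a) b p)
    (λ k : Nat, λ r : (Π a : N, Π b : N, T k a b ⇒ W a b),
     λ a : N, λ b : N, λ q : T (succ k) a b,
      let S := E a × T k (f a) b in
      consIn (symm G) a (f a) b (i a (pr1 S q)) (r (f a) b (pr2 S q)))
    k a b q.

(** The image of a walk in [symm A] under a homomorphism [(α, β)] from [A] to
    [symm G]. *)
Definition walkImage (A G : graph) (α β a b w : exp) : exp :=
  let SA := symm A in
  let SG := symm G in
  indWalk (node SA) (edgeL SA)
    (λ a : node SA, λ b : node SA, λ _ : WalkIn SA a b,
      WalkIn SG (α a) (α b))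
    (λ a : node SA, nilIn SG (α a))
    (λ a : node SA, λ c : node SA, λ b : node SA,
     λ e : edge SA a c, λ _ : WalkIn SA c b, λ r : WalkIn SG (α c) (α b),
      consIn SG (α a) (α c) (α b)
        (indSum (edge A a c) (edge A c a)
          (λ _ : edge SA a c, edge SG (α a) (α c))
          (λ e : edge A a c, β a c e)
          (λ e : edge A c a, flip G (α c) (α a) (β c a e))
          e)
        r)
    a b w.

(** The clockwise walk from [a] to [b] follows the edges [x -> suc x]; its
    length is less than the size of the cycle unless [a = b], when it goes once
    around.  The counterclockwise walk follows the reversed edges
    [x -> pred x]; its length is zero if [a = b], and otherwise less than the
    size of the cycle.  Each of the two walks is presented by its length and its
    edges, of which there is exactly one choice. *)
Definition cwStep (A : cyclic) (x : exp) : exp := edge A x (csuc A x).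
Definition cwEdge (A : cyclic) (x e : exp) : exp :=
  inl (edge A x (csuc A x)) (edge A (csuc A x) x) e.
Definition CwSteps (A : cyclic) (k a b : exp) : exp :=
  Steps A (csuc A) (cwStep A) k a b.
Definition IsCwLength (A : cyclic) (k a b : exp) : sigma :=
  (Id (node A) a b ⇒ Id Nat k (csize A)) ×
  (not (Id (node A) a b) ⇒ lt k (csize A)).
Definition cwWalk (A : cyclic) (k a b q : exp) : exp :=
  stepsWalk A (csuc A) (cwStep A) (cwEdge A) k a b q.

Definition ccwStep (A : cyclic) (x : exp) : exp := edge A (cpred A x) x.
Definition ccwEdge (A : cyclic) (x e : exp) : exp :=
  inr (edge A x (cpred A x)) (edge A (cpred A x) x) e.
Definition CcwSteps (A : cyclic) (k a b : exp) : exp :=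
  Steps A (cpred A) (ccwStep A) k a b.
Definition IsCcwLength (A : cyclic) (k a b : exp) : sigma :=
  (Id (node A) a b ⇒ Id Nat k zero) ×
  (not (Id (node A) a b) ⇒ lt k (csize A)).
Definition ccwWalk (A : cyclic) (k a b q : exp) : exp :=
  stepsWalk A (cpred A) (ccwStep A) (ccwEdge A) k a b q.

(** * Homotopy of walks, spherical and planar maps *)

(** [w] and [w'] are the two sides of an instance of hcollapse. *)
Definition Collapse (G : graph) (M x y w w' : exp) : exp :=
  let SG := symm G in
  ΣFace G M (fun A α β =>
    Σ a : node A, Σ b : node A,
    Σ w1 : WalkIn SG x (α a), Σ w2 : WalkIn SG (α b) y,
    Σ k : Nat, Σ q : CcwSteps A k a b, IsCcwLength A k a b ×
    (Σ l : Nat, Σ r : CwSteps A l a b, IsCwLength A l a b ×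
      let around u :=
        concat SG x (α a) y w1
          (concat SG (α a) (α b) y (walkImage A G α β a b u) w2) in
      Id (WalkIn SG x y) w (around (ccwWalk A k a b q)) ×
      Id (WalkIn SG x y) w' (around (cwWalk A l a b r)))).

Definition Homotopy (G : graph) (M x y w w' : exp) : exp :=
  let W := WalkIn (symm G) x y in
  EqvR W (λ w : W, λ w' : W, Collapse G M x y w w') w w'.

Definition Spherical (G : graph) (M : exp) : exp :=
  Π x : node G, Π y : node G,
  Π w : WalkIn (symm G) x y, Π w' : WalkIn (symm G) x y,
    Trunc (Homotopy G M x y w w').

Definition Planar (G : graph) : sigma :=
  Σ M : Map G, Spherical G M × Face G M.

(* Main.v *)
(** A derivation exists because an explicit proof term is accepted by a type
    checker that is sound with respect to [typed].

    As [Map] is a set and [Spherical] a proposition, the point is that [Face]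
    is a set. A path between two faces acts on the nodes of their cyclic
    graphs. Label a node [a] of a cyclic graph by the set of images in [G] of
    the edges into [a]. Paths preserve labels, and labels are injective:
    homomorphisms of faces are injective on edges, and every node of [C_n] has
    an incoming edge, unless [n = 0], when there is one node only. Hence two
    paths between the same faces act on nodes in the same way, so that by
    univalence they agree on the types of nodes. Edges of cyclic graphs form
    propositions, and all other components of a face lie in sets. *)

From Stdlib Require Import List Arith Bool Lia.
Import ListNotations.
Require Import Defs.

(** * Weakening and substitution *)

(* The universe is not a set, so closure of sets under sums does not reach two components of a face:
   the type of nodes and the family of edges. A cyclic graph alone cannot repair this, since for $n
   \ge 2$ the rotations of $C_n$ give distinct loops at it; only the homomorphism into $G$ makes it
   rigid. Labels are taken from edges rather than nodes, because a face may pass several times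
   through one node of $G$, but at most once through an edge in a given direction. A label is a
   family over all edges of $U(G)$ and not a chosen edge: it is then defined without the position of
   a node in the cycle, which is known only under a truncation, and the truncation is opened for
   propositions only.

   The checker runs on fuel and only its positive answers are proved correct. Definitional equality
   relates raw terms, so that whatever a typed equality would guarantee, such as matching parameters
   or the typing of a reduct, is tested by the checker. *)
Scheme typed_mut := Induction for typed Sort Prop
  with wf_mut := Induction for wf Sort Prop.
Combined Scheme typed_wf_ind from typed_mut, wf_mut.

Ltac nat_tests :=
  repeat (match goal with
  | |- context [?a <=? ?b] => destruct (Nat.leb_spec a b)
  | |- context [?a <? ?b] => destruct (Nat.ltb_spec a b)
  | |- context [?a =? ?b] => destruct (Nat.eqb_spec a b)
  | H : context [?a <=? ?b] |- _ => destruct (Nat.leb_spec a b)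
  | H : context [?a =? ?b] |- _ => destruct (Nat.eqb_spec a b)
  end; cbn [shift subst]; try lia).

Ltac congr :=
  cbn [shift subst]; lazymatch goal with
  | |- context [Nat.leb] => nat_tests; solve [trivial | f_equal; lia]
  | |- context [Nat.eqb] => nat_tests; solve [trivial | f_equal; lia]
  | _ => f_equal; auto with arith
  end.

Lemma shift_shift (t : tm) (k l : nat) :
  k <= l -> shift (S l) (shift k t) = shift k (shift l t).
Proof.
  revert k l; induction t; intros k l kl; congr.
Qed.

Lemma subst_shift (t u : tm) (k : nat) : subst k u (shift k t) = t.
Proof.
  revert k u; induction t; intros k u; congr.
Qed.

Lemma shift_subst_above (t u : tm) (k n : nat) :
  k <= n -> shift k (subst n u t) = subst (S n) (shift k u) (shift k t).
Proof.
  revert k n u; induction t; intros k l u kl; congr.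
  - rewrite IHt2 by lia; now rewrite shift_shift by lia.
  - rewrite IHt2 by lia; now rewrite shift_shift by lia.
Qed.

Lemma shift_subst_below (t u : tm) (k n : nat) :
  n <= k -> shift k (subst n u t) = subst n (shift k u) (shift (S k) t).
Proof.
  revert k n u; induction t; intros k l u kl; congr.
  - rewrite IHt2 by lia; now rewrite shift_shift by lia.
  - rewrite IHt2 by lia; now rewrite shift_shift by lia.
Qed.

Lemma subst_subst (t u v : tm) (k n : nat) :
  n <= k ->
  subst k v (subst n u t) = subst n (subst k v u) (subst (S k) (shift n v) t).
Proof.
  revert k n u v; induction t; intros k l u v kl;
    [cbn [shift subst]; nat_tests; rewrite ?subst_shift;
     solve [trivial | f_equal; lia]|congr..].
  - rewrite IHt2 by lia.
    rewrite <- shift_subst_above, shift_shift by lia; trivial.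
  - rewrite IHt2 by lia.
    rewrite <- shift_subst_above, shift_shift by lia; trivial.
Qed.

Lemma subst_var_shift (t : tm) (k : nat) : subst k (Var k) (shift (S k) t) = t.
Proof.
  revert k; induction t; intros k; [congr|simpl; f_equal; auto..].
Qed.

Lemma iota_shift (k : nat) (t u : tm) : iota t u -> iota (shift k t) (shift k u).
Proof. intros [ ]; constructor. Qed.

Lemma iota_subst (k : nat) (v t u : tm) :
  iota t u -> iota (subst k v t) (subst k v u).
Proof. intros [ ]; constructor. Qed.

Lemma defeq_shift (k : nat) (t u : tm) :
  defeq t u -> defeq (shift k t) (shift k u).
Proof.
  intros H; revert k; induction H; intros k; simpl; eauto using defeq.
  - rewrite shift_subst_below by lia; apply defeq_beta.
  - rewrite shift_shift by lia; apply defeq_eta.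
  - apply defeq_iota, iota_shift; assumption.
Qed.

Lemma defeq_subst (k : nat) (s t u : tm) :
  defeq t u -> defeq (subst k s t) (subst k s u).
Proof.
  intros H; revert k s; induction H; intros k s; simpl; eauto using defeq.
  - rewrite subst_subst by lia; apply defeq_beta.
  - rewrite <- shift_subst_above by lia; apply defeq_eta.
  - apply defeq_iota, iota_subst; assumption.
Qed.

Lemma shift_const_type (c : const) (i j k : nat) :
  shift k (closed (const_type c i j)) = closed (const_type c i j).
Proof. destruct c; reflexivity. Qed.

Lemma subst_const_type (c : const) (i j k : nat) (u : tm) :
  subst k u (closed (const_type c i j)) = closed (const_type c i j).
Proof. destruct c; reflexivity. Qed.

Notation lift n t := (Nat.iter n (shift 0) t).

(** [insertion k Δ Γ]: [Γ] is [Δ] with one more type at position [k]. *)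
Inductive insertion : nat -> list tm -> list tm -> Prop :=
| insertion_O Γ A i : typed Γ A (Univ i) -> insertion 0 Γ (A :: Γ)
| insertion_S k Γ Γ' B :
    insertion k Γ Γ' -> insertion (S k) (B :: Γ) (shift k B :: Γ').

Lemma insertion_nth (k : nat) (Γ Γ' : list tm) :
  insertion k Γ Γ' -> forall n A, nth_error Γ n = Some A ->
  exists n' A', nth_error Γ' n' = Some A' /\ shift k (Var n) = Var n' /\
    shift k (lift (S n) A) = lift (S n') A'.
Proof.
  induction 1 as [Γ X i _|k Γ Γ' B _ IH]; intros n A HA.
  - now exists (S n), A.
  - destruct n as [|n]; simpl in HA.
    + injection HA as <-. exists 0, (shift k B); repeat split; simpl.
      now rewrite shift_shift by lia.
    + destruct (IH n A HA) as (n' & A' & H1 & H2 & H3).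
      exists (S n'), A'; repeat split; trivial.
      * simpl in H2 |- *. destruct n; simpl in *; revert H2; nat_tests; congruence.
      * change (lift (S (S n)) A) with (shift 0 (lift (S n) A)).
        rewrite shift_shift by lia. now rewrite H3.
Qed.

Lemma weakening :
  (forall Γ t T, typed Γ t T -> forall k Γ',
    insertion k Γ Γ' -> typed Γ' (shift k t) (shift k T)) /\
  (forall Γ, wf Γ -> forall k Γ', insertion k Γ Γ' -> wf Γ').
Proof.
  apply typed_wf_ind; intros.
  - destruct (insertion_nth _ _ _ H0 _ _ e) as (n' & A' & H1 & H2 & H3).
    rewrite H2, H3; constructor; eauto.
  - constructor; eauto.
  - apply typed_cumul; eauto.
  - simpl; apply typed_Pi; [eapply H|eapply H0; constructor]; eassumption.
  - simpl; apply typed_Lam, H; constructor; eassumption.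
  - rewrite shift_subst_below by lia; simpl.
    eapply typed_App; [eapply H|eapply H0]; eassumption.
  - rewrite shift_const_type; constructor; eauto.
  - eapply typed_conv; [eauto|apply defeq_shift; eassumption|].
    apply (H0 _ _ H1).
  - inversion H; subst; econstructor; eassumption.
  - inversion H0; subst.
    + econstructor; econstructor; eassumption.
    + econstructor; eapply H; eassumption.
Qed.

(** [typed_Lam] has a premise over [A :: Γ] but none over [Γ]. With the claim made for all suffixes,
    the case of abstractions drops one more entry. *)
Lemma wf_suffixes :
  (forall Γ t T, typed Γ t T -> forall n, wf (skipn n Γ)) /\
  (forall Γ, wf Γ -> forall n, wf (skipn n Γ)).
Proof.
  apply typed_wf_ind; intros; auto.
  - apply (H (S n)).
  - destruct n; constructor.
  - destruct n; simpl; [econstructor; eassumption|auto].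
Qed.

Lemma typed_wf (Γ : list tm) (t T : tm) : typed Γ t T -> wf Γ.
Proof. intros H; apply (proj1 wf_suffixes _ _ _ H 0). Qed.

Lemma typed_shift (Γ : list tm) (A t T : tm) (i : nat) :
  typed Γ A (Univ i) -> typed Γ t T ->
  typed (A :: Γ) (shift 0 t) (shift 0 T).
Proof.
  intros HA Ht; apply (proj1 weakening _ _ _ Ht). econstructor; eassumption.
Qed.

Inductive substitution : nat -> tm -> list tm -> list tm -> Prop :=
| substitution_O Γ A u : typed Γ u A -> substitution 0 u (A :: Γ) Γ
| substitution_S k u Γ Γ' B :
    substitution k u Γ Γ' ->
    substitution (S k) (shift 0 u) (B :: Γ) (subst k u B :: Γ').

Lemma substitution_nth (k : nat) (u : tm) (Γ Γ' : list tm) :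
  substitution k u Γ Γ' -> wf Γ' -> forall n A, nth_error Γ n = Some A ->
  typed Γ' (subst k u (Var n)) (subst k u (lift (S n) A)).
Proof.
  induction 1 as [Γ X u Hu|k u Γ Γ' B _ IH]; intros W n A HA.
  - destruct n as [|n]; simpl in HA.
    + injection HA as <-. simpl. now rewrite subst_shift.
    + simpl. rewrite subst_shift.
      now apply (typed_Var Γ A n).
  - inversion W as [|Γ0 C i HC]; subst.
    destruct n as [|n]; simpl in HA.
    + injection HA as <-. simpl.
      rewrite <- shift_subst_above by lia.
      now apply (typed_Var _ _ 0).
    + change (lift (S (S n)) A) with (shift 0 (lift (S n) A)).
      change (Var (S n)) with (shift 0 (Var n)).
      rewrite <- !shift_subst_above by lia.
      eapply typed_shift; [eassumption|].
      apply IH; [eapply typed_wf|]; eassumption.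
Qed.

Lemma substitutivity :
  (forall Γ t T, typed Γ t T -> forall k u Γ',
    substitution k u Γ Γ' -> typed Γ' (subst k u t) (subst k u T)) /\
  (forall Γ, wf Γ -> forall k u Γ', substitution k u Γ Γ' -> wf Γ').
Proof.
  apply typed_wf_ind; intros.
  - eapply substitution_nth; eauto.
  - constructor; eauto.
  - apply typed_cumul; eauto.
  - simpl; apply typed_Pi; [eapply H|eapply H0; constructor]; eassumption.
  - simpl; apply typed_Lam, H; constructor; eassumption.
  - rewrite subst_subst by lia; simpl.
    eapply typed_App; [eapply H|eapply H0]; eassumption.
  - rewrite subst_const_type; constructor; eauto.
  - eapply typed_conv; [eauto|apply defeq_subst; eassumption|].
    apply (H0 _ _ _ H1).
  - inversion H.
  - inversion H0; subst.
    + eapply typed_wf; eassumption.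
    + econstructor; eapply H; eassumption.
Qed.

Lemma typed_subst (Γ : list tm) (A t T u : tm) :
  typed (A :: Γ) t T -> typed Γ u A -> typed Γ (subst 0 u t) (subst 0 u T).
Proof.
  intros Ht Hu; apply (proj1 substitutivity _ _ _ Ht); now constructor.
Qed.

(** * Types at an unspecified level *)

Definition is_type (Γ : list tm) (A : tm) : Prop := exists i, typed Γ A (Univ i).

Lemma typed_cumul_le (Γ : list tm) (A : tm) (i j : nat) :
  i <= j -> typed Γ A (Univ i) -> typed Γ A (Univ j).
Proof. induction 1; auto using typed_cumul. Qed.

Lemma is_type_Pi (Γ : list tm) (A B : tm) :
  is_type Γ A -> is_type (A :: Γ) B -> is_type Γ (Pi A B).
Proof.
  intros [i HA] [j HB]; exists (Nat.max i j).
  apply typed_Pi; eapply typed_cumul_le; try eassumption; lia.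
Qed.

(** The conclusion does not mention the level, so conversion and cumulativity, which leave the term
    alone, pass it on; only [typed_Pi] remains. *)
Lemma is_type_Pi_inv (Γ : list tm) (A B : tm) :
  is_type Γ (Pi A B) -> is_type Γ A /\ is_type (A :: Γ) B.
Proof.
  intros [i H]; remember (Pi A B) as P eqn:HP; revert HP.
  induction H; intros HP; try discriminate; auto.
  injection HP as -> ->; split; eexists; eassumption.
Qed.

(** A variable of type [A] is inserted behind the one of type [A'], and then, converted to [A'], is
    substituted for it. *)
Lemma is_type_context_conv (Γ : list tm) (A A' B : tm) :
  defeq A A' -> is_type Γ A -> is_type Γ A' ->
  is_type (A' :: Γ) B -> is_type (A :: Γ) B.
Proof.
  intros E [i HA] [i' HA'] [j HB]; exists j.
  rewrite <- (subst_var_shift B 0).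
  apply (typed_subst (A :: Γ) (shift 0 A') _ (Univ j)).
  - eapply (proj1 weakening _ _ _ HB 1).
    constructor; econstructor; eassumption.
  - eapply typed_conv; [apply (typed_Var _ A 0); [econstructor; eassumption|reflexivity]
      |apply defeq_shift; eassumption|].
    exact (typed_shift _ _ _ _ _ HA HA').
Qed.

(** * Reduction and conversion *)

Fixpoint lift_by (d k : nat) (t : tm) : tm :=
  match t with
  | Var n => if k <=? n then Var (d + n) else Var n
  | Univ i => Univ i
  | Pi A B => Pi (lift_by d k A) (lift_by d (S k) B)
  | Lam A t => Lam (lift_by d k A) (lift_by d (S k) t)
  | App t u => App (lift_by d k t) (lift_by d k u)
  | Const c => Const c
  end.

Lemma lift_by_S (t : tm) (d k : nat) :
  lift_by (S d) k t = shift k (lift_by d k t).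
Proof.
  revert k; induction t; intros k; cbn [lift_by shift]; f_equal; auto.
  nat_tests; f_equal; lia.
Qed.

Lemma lift_by_0 (t : tm) (k : nat) : lift_by 0 k t = t.
Proof.
  revert k; induction t; intros k; cbn [lift_by shift]; f_equal; auto.
  now destruct (k <=? n).
Qed.

Lemma lift_by_lift (t : tm) (d : nat) : lift_by d 0 t = lift d t.
Proof.
  induction d as [|d IH]; [apply lift_by_0|].
  now rewrite lift_by_S, IH.
Qed.

(** Substitution at [d] of a term that lives outside of [d] further binders;
    unlike [subst] it lifts [u] only at the variables that it replaces. *)
Fixpoint inst (d : nat) (u t : tm) : tm :=
  match t with
  | Var n => if n =? d then lift_by d 0 u else if d <? n then Var (pred n) else Var n
  | Univ i => Univ i
  | Pi A B => Pi (inst d u A) (inst (S d) u B)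
  | Lam A t => Lam (inst d u A) (inst (S d) u t)
  | App t v => App (inst d u t) (inst d u v)
  | Const c => Const c
  end.

Lemma inst_subst_lift (t u : tm) (d : nat) : inst d u t = subst d (lift d u) t.
Proof.
  revert d; induction t; intros d; cbn [inst subst]; f_equal; auto.
  now rewrite lift_by_lift.
Qed.

Lemma inst_subst (t u : tm) : inst 0 u t = subst 0 u t.
Proof. apply inst_subst_lift. Qed.

(* Syntactic equality and weak head reduction *)
Scheme Boolean Equality for const.

Lemma const_beq_eq (c d : const) : const_beq c d = true -> c = d.
Proof. now destruct c, d. Qed.

(** Unlike [&&] and [||], these do not evaluate their second argument needlessly
    under call by value. *)
Local Notation "b &&& c" := (if b then c else false)
  (at level 40, left associativity).
Local Notation "b ||| c" := (if b then true else c)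
  (at level 50, left associativity).

Lemma and_then (b c : bool) : b &&& c = true -> b = true /\ c = true.
Proof. now destruct b. Qed.

Lemma or_else (b c : bool) : b ||| c = true -> b = true \/ c = true.
Proof. destruct b; auto. Qed.

Fixpoint tm_eqb (t u : tm) : bool :=
  match t, u with
  | Var n, Var m => n =? m
  | Univ i, Univ j => i =? j
  | Pi A B, Pi A' B' => tm_eqb A A' &&& tm_eqb B B'
  | Lam A t, Lam A' t' => tm_eqb A A' &&& tm_eqb t t'
  | App t u, App t' u' => tm_eqb t t' &&& tm_eqb u u'
  | Const c, Const d => const_beq c d
  | _, _ => false
  end.

Lemma tm_eqb_eq (t u : tm) : tm_eqb t u = true -> t = u.
Proof.
  revert u; induction t; intros [ ]; simpl; intros H; try discriminate;
    try apply and_then in H as [H1 H2]; f_equal; auto;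
    try apply Nat.eqb_eq; try apply const_beq_eq; trivial.
Qed.

Definition apps (h : tm) (args : list tm) : tm := fold_left App args h.

Fixpoint unapps (t : tm) (args : list tm) : tm * list tm :=
  match t with
  | App f a => unapps f (a :: args)
  | _ => (t, args)
  end.

Lemma unapps_apps (t : tm) (args : list tm) (h : tm) (l : list tm) :
  unapps t args = (h, l) -> apps t args = apps h l.
Proof.
  revert args; induction t; intros args H; simpl in H;
    try (injection H as <- <-; reflexivity).
  exact (IHt1 _ H).
Qed.

(** Computation rules for walks and for [EqvR] are never needed. *)
Fixpoint whnf (n : nat) (t : tm) : tm :=
  match n with 0 => t | S n =>
    match t with
    | App f a =>
        match whnf n f with
        | Lam _ b => whnf n (inst 0 a b)
        | f' =>
            match reduce n (App f' a) with
            | Some r => whnf n r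
            | None => App f' a
            end
        end
    | _ => t
    end
  end

with reduce (n : nat) (t : tm) : option tm :=
  match n with 0 => None | S n =>
    match unapps t List.nil with
    | (Const cIndOne, [C; c; x]) =>
        match whnf n x with Const cTt => Some c | _ => None end
    | (Const cIndSum, [A; B; C; f; g; x]) =>
        match unapps (whnf n x) List.nil with
        | (Const cInl, [A'; B'; a]) =>
            if conv n A' A &&& conv n B' B then Some (App f a) else None
        | (Const cInr, [A'; B'; b]) =>
            if conv n A' A &&& conv n B' B then Some (App g b) else None
        | _ => None
        end
    | (Const cIndSigma, [A; B; C; f; x]) =>
        match unapps (whnf n x) List.nil with
        | (Const cPair, [A'; B'; a; b]) =>
            if conv n A' A &&& conv n B' B then Some (App (App f a) b) else None
        | _ => None
        end
    | (Const cIndNat, [C; z; s; x]) =>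
        match whnf n x with
        | Const cO => Some z
        | App (Const cS) m =>
            Some (App (App s m) (apps (Const cIndNat) [C; z; s; m]))
        | _ => None
        end
    | (Const cJ, [A; a; C; d; b; p]) =>
        match unapps (whnf n p) List.nil with
        | (Const cRefl, [A'; a']) =>
            if conv n A' A &&& conv n a' a &&& conv n b a then Some d else None
        | _ => None
        end
    | (Const cTrRec, [A; P; h; f; x]) =>
        match unapps (whnf n x) List.nil with
        | (Const cTr, [A'; a]) =>
            if conv n A' A then Some (App f a) else None
        | _ => None
        end
    | _ => None
    end
  end

with conv (n : nat) (t u : tm) : bool :=
  match n with 0 => false | S n =>
    if tm_eqb t u then true else
    match whnf n t, whnf n u with
    | Pi A B, Pi A' B' => conv n A A' &&& conv n B B'
    | Lam A b, Lam A' b' => conv n A A' &&& conv n b b'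
    | Lam A b, u' => conv n b (App (shift 0 u') (Var 0))
    | t', Lam A b => conv n (App (shift 0 t') (Var 0)) b
    | App f a, App g b => conv n f g &&& conv n a b
    | t', u' => tm_eqb t' u'
    end
  end.

Lemma defeq_eta_lam (A b t : tm) :
  defeq b (App (shift 0 t) (Var 0)) -> defeq (Lam A b) t.
Proof. eauto using defeq. Qed.

Ltac step_congr :=
  repeat first [apply defeq_refl | eassumption | apply defeq_App].

Ltac explode E :=
  repeat match type of E with
  | match ?l with List.nil => _ | _ => _ end = _ =>
      destruct l; try discriminate
  end.

Ltac match_value Hx E :=
  match type of E with match unapps ?x List.nil with _ => _ end = _ =>
    let v := fresh in let h := fresh in let l := fresh in let c := fresh in
    destruct (unapps x List.nil) as [h l] eqn:v; apply Hx in v;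
    destruct h as [ | | | | |c]; try discriminate;
    destruct c; try discriminate; explode E
  end.

Ltac by_iota rule :=
  match goal with
  | E : (if ?b then Some _ else None) = Some _, C : forall t u, conv _ t u = true -> _
      |- _ =>
      let Eb := fresh in
      destruct b eqn:Eb; [injection E as <-|discriminate];
      repeat match goal with
      | H : _ &&& _ = true |- _ => apply and_then in H; destruct H
      end;
      repeat match goal with
      | H : conv _ _ _ = true |- _ => apply C in H
      end
  end;
  simpl in *; (eapply defeq_trans; [|apply defeq_iota, rule]); step_congr;
  (eapply defeq_trans; [eassumption|]); step_congr.

(** The three functions call each other, whence one induction on their fuel. The rules of [iota]
    want literally the same parameters in eliminator and constructor, while [reduce] finds them
    convertible; congruence first exchanges those of the constructor. *)
Lemma reduction_sound (n : nat) :
  (forall t, defeq t (whnf n t)) /\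
  (forall t r, reduce n t = Some r -> defeq t r) /\
  (forall t u, conv n t u = true -> defeq t u).
Proof.
  induction n as [|n (W & R & C)]; repeat split; try discriminate.
  - apply defeq_refl.
  - intros t; simpl; destruct t as [ | | | |f a| ]; try apply defeq_refl.
    assert (Hf : defeq (App f a) (App (whnf n f) a))
      by (apply defeq_App; auto using defeq_refl).
    apply (defeq_trans _ _ _ Hf); clear Hf.
    assert (G : forall f', defeq (App f' a)
        match reduce n (App f' a) with
        | Some r => whnf n r | None => App f' a end).
    { intros f'; destruct (reduce n (App f' a)) eqn:E; [|apply defeq_refl].
      exact (defeq_trans _ _ _ (R _ _ E) (W _)). }
    destruct (whnf n f); try apply G.
    rewrite inst_subst; eapply defeq_trans; [apply defeq_beta|apply W].
  - intros t r; cbn [reduce].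
    destruct (unapps t List.nil) as [h l] eqn:Ht.
    apply unapps_apps in Ht; change (apps t List.nil) with t in Ht; subst t.
    assert (Hx : forall x h' l', unapps (whnf n x) List.nil = (h', l') ->
        defeq x (apps h' l')).
    { intros x h' l' Hx. apply unapps_apps in Hx. rewrite <- Hx. apply W. }
    intros E; destruct h as [ | | | | |c]; try discriminate;
      destruct c; try discriminate;
      explode E.
    + match goal with |- defeq (apps _ [_; _; ?x]) _ => specialize (W x) end.
      destruct (whnf n _) as [ | | | | |c]; try discriminate;
        destruct c; try discriminate.
      injection E as <-; eapply defeq_trans; [|apply defeq_iota, iota_One].
      simpl; step_congr.
    + match_value Hx E; [by_iota iota_inl|by_iota iota_inr].
    + match_value Hx E; by_iota iota_pair.
    + match goal with |- defeq (apps _ [_; _; _; ?x]) _ => specialize (W x) end.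
      destruct (whnf n _) as [ | | | |f m|c]; try discriminate;
        [destruct f as [ | | | | |c]; try discriminate|];
        destruct c; try discriminate; injection E as <-;
        (eapply defeq_trans; [|apply defeq_iota; (apply iota_S || apply iota_O)]);
        simpl; step_congr.
    + match_value Hx E; by_iota iota_refl.
    + match_value Hx E; by_iota iota_tr.
  - intros t u; cbn [conv].
    destruct (tm_eqb t u) eqn:E; [intros _; apply tm_eqb_eq in E as <-; apply defeq_refl|].
    intros H; apply (defeq_trans _ _ _ (W t)), defeq_sym,
      (defeq_trans _ _ _ (W u)), defeq_sym.
    destruct (whnf n t), (whnf n u);
      try (apply tm_eqb_eq in H as <-; apply defeq_refl);
      try (apply defeq_eta_lam, C; exact H);
      try (apply defeq_sym, defeq_eta_lam, defeq_sym, C; exact H);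
      apply and_then in H as [H1 H2]; apply C in H1, H2;
      first [apply defeq_Pi | apply defeq_Lam | apply defeq_App]; assumption.
Qed.

Lemma whnf_sound (n : nat) (t : tm) : defeq t (whnf n t).
Proof. apply reduction_sound. Qed.

Lemma conv_sound (n : nat) (t u : tm) : conv n t u = true -> defeq t u.
Proof. apply reduction_sound. Qed.

(** One bottom-up pass, which is structural and takes no fuel; redexes that a substitution creates
    inside its result are left. *)
Fixpoint beta (t : tm) : tm :=
  match t with
  | Pi A B => Pi (beta A) (beta B)
  | Lam A t => Lam (beta A) (beta t)
  | App f a =>
      match beta f with
      | Lam _ b => inst 0 (beta a) b
      | f' => App f' (beta a)
      end
  | _ => t
  end.

Lemma beta_sound (t : tm) : defeq t (beta t).
Proof.
  induction t as [ | |A IHA B IHB|A IHA t IHt|f IHf a IHa| ]; simpl;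
    auto using defeq_refl, defeq_Pi, defeq_Lam.
  pose proof (defeq_App _ _ _ _ IHf IHa) as E.
  destruct (beta f); trivial.
  rewrite inst_subst; eauto using defeq_trans, defeq_beta.
Qed.

(** Instances of lemmas differ from the expected types mostly by contraction of
    redexes, which is much faster to test than convertibility. *)
Fixpoint beta_eqb (t u : tm) : bool :=
  tm_eqb t u |||
  match t, u with
  | Pi A B, Pi A' B' => beta_eqb A A' &&& beta_eqb B B'
  | App f a, App g b => tm_eqb f g &&& beta_eqb a b ||| tm_eqb (beta t) (beta u)
  | _, _ => tm_eqb (beta t) (beta u)
  end.

Lemma beta_eqb_sound (t u : tm) : beta_eqb t u = true -> defeq t u.
Proof.
  assert (N : forall t u, tm_eqb (beta t) (beta u) = true -> defeq t u).
  { clear; intros t u E; apply tm_eqb_eq in E.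
    apply (defeq_trans _ _ _ (beta_sound t)); rewrite E.
    apply defeq_sym, beta_sound. }
  revert u; induction t; intros u H; cbn [beta_eqb] in H;
    apply or_else in H as [H|H];
    try (apply tm_eqb_eq in H as <-; apply defeq_refl);
    destruct u; try (apply N, H).
  - apply and_then in H as [H1 H2]; apply defeq_Pi; auto.
  - apply or_else in H as [H|H]; [|apply N, H].
    apply and_then in H as [H1 H2]; apply tm_eqb_eq in H1 as <-.
    apply defeq_App; auto using defeq_refl.
Qed.

Definition equiv (n : nat) (t u : tm) : bool := beta_eqb t u ||| conv n t u.

Lemma equiv_sound (n : nat) (t u : tm) : equiv n t u = true -> defeq t u.
Proof.
  intros H; apply or_else in H as [H|H];
    [apply beta_eqb_sound, H|apply conv_sound in H; exact H].
Qed.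

(** * Type inference *)

Definition sort (n : nat) (T : tm) : option nat :=
  match whnf n T with Univ i => Some i | _ => None end.

Fixpoint codomain_level (n : nat) (T : tm) : nat :=
  match n with 0 => 0 | S n =>
    match whnf n T with
    | Univ i => i
    | Pi _ B => codomain_level n B
    | _ => 0
    end
  end.

(** The arguments of a constant whose types mention its levels [i] and [j]. *)
Definition level_arguments (c : const) : list nat * list nat :=
  match c with
  | cZero | cOne | cTt | cNat | cO | cS => ([], [])
  | cIndZero | cIndOne | cIndNat => ([], [0])
  | cSum | cInl | cInr | cSigma | cPair | cWalk | cNil | cCons
  | cEqvR | cEqvIncl | cEqvRefl | cEqvSym | cEqvTrans
  | cFunext | cUnivalence => ([0; 1], [])
  | cIndSum | cIndSigma | cIndWalk | cIndEqvR => ([0; 1], [2])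
  | cId | cRefl | cTrunc | cTr | cTrPath => ([0], [])
  | cJ => ([0], [2])
  | cTrRec => ([0], [1])
  end.

(** A guess that needs no justification: [typed_Const] holds at all levels, and the arguments are
    checked against the type at the guessed one. A missing argument counts as level 0. *)
Definition max_level (n : nat) (args : list (tm * tm)) (l : list nat) : nat :=
  list_max (map (fun k => codomain_level n (snd (nth k args (Univ 0, Univ 0)))) l).

(** The type of a constant mentions only constants of smaller rank, so that the
    types of constants can be checked in order of rank. *)
Definition rank (c : const) : nat :=
  match c with
  | cZero | cOne | cSum | cSigma | cNat | cId | cTrunc | cWalk | cEqvR => 0
  | cTt | cInl | cInr | cPair | cO | cS | cRefl | cTr | cNil | cCons
  | cEqvIncl | cEqvRefl | cEqvSym | cEqvTrans => 1
  | cFunext | cUnivalence => 3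
  | _ => 2
  end.

(** Univalence for [U i] is itself stated with constants of level [i + 1]. *)
Definition level_bound (c : const) : nat :=
  match c with cUnivalence => 1 | _ => 2 end.

(** The inferred type [T] of [t] can be replaced by [T']; cumulativity is
    propagated to the codomains of the types of abstractions. *)
Fixpoint fits (n : nat) (t T T' : tm) : bool :=
  if tm_eqb T T' then true else
  match t, T, T' with
  | Lam _ b, Pi A B, Pi A' B' => equiv n A A' &&& fits n b B B'
  | _, _, _ =>
      match sort n T, sort n T' with
      | Some i, Some j => i <=? j
      | _, _ => equiv n T T'
      end
  end.

(** [infer r n Γ t args] is the type of [t] applied to [args], which are paired
    with their types; only constants of rank less than [r] are admitted. *)
Fixpoint infer (r n : nat) (Γ : list tm) (t : tm) (args : list (tm * tm))
    : option tm :=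
  match n with 0 => None | S n =>
    match t with
    | Var k =>
        match nth_error Γ k with
        | Some A => spine r n Γ (lift_by (S k) 0 A) args
        | None => None
        end
    | Univ i => spine r n Γ (Univ (S i)) args
    | Pi A B =>
        match infer r n Γ A [], infer r n (A :: Γ) B [] with
        | Some K, Some L =>
            match sort n K, sort n L with
            | Some i, Some j => spine r n Γ (Univ (Nat.max i j)) args
            | _, _ => None
            end
        | _, _ => None
        end
    | Lam A b =>
        match infer r n Γ A [], infer r n (A :: Γ) b [] with
        | Some K, Some B =>
            match sort n K with
            | Some _ => spine r n Γ (Pi A B) args
            | None => None
            end
        | _, _ => None
        end
    | App f a =>
        match infer r n Γ a [] with
        | Some A => infer r n Γ f ((a, A) :: args)
        | None => None
        end
    | Const c =>
        let (li, lj) := level_arguments c in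
        let i := max_level n args li in
        let j := max_level n args lj in
        if (rank c <? r) && (i <=? level_bound c) && (j <=? 2)
        then spine r n Γ (closed (const_type c i j)) args
        else None
    end
  end

with spine (r n : nat) (Γ : list tm) (T : tm) (args : list (tm * tm))
    : option tm :=
  match n, args with
  | 0, _ => None
  | _, List.nil => Some T
  | S n, (u, U) :: args =>
      match T with
      | Pi A B =>
          if fits n u U A then spine r n Γ (inst 0 u B) args else None
      | _ =>
          (* Subject reduction is not available: the product is typed again. *)
          match whnf n T with
          | Pi A B =>
              match infer r n Γ (Pi A B) [] with
              | Some K =>
                  match sort n K with
                  | Some _ =>
                      if fits n u U A then spine r n Γ (inst 0 u B) args
                      else None
                  | None => None
                  end
              | None => None
              end
          | _ => None
          end
      end
  end.

Lemma sort_sound (n : nat) (T : tm) (i : nat) :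
  sort n T = Some i -> defeq T (Univ i).
Proof.
  unfold sort; intros H. pose proof (whnf_sound n T) as W.
  destruct (whnf n T); try discriminate. now injection H as <-.
Qed.

(** Typing in which the type of an abstraction is literally a product. *)
Fixpoint infers (Γ : list tm) (t T : tm) : Prop :=
  match t with
  | Lam A b => exists B, T = Pi A B /\ is_type Γ A /\ infers (A :: Γ) b B
  | _ => typed Γ t T
  end.

Lemma infers_typed (Γ : list tm) (t T : tm) : infers Γ t T -> typed Γ t T.
Proof.
  revert Γ T; induction t; intros Γ T H; trivial.
  destruct H as (B & -> & _ & HB); apply typed_Lam; auto.
Qed.

Lemma typed_conv_type (Γ : list tm) (t T T' : tm) :
  typed Γ t T -> defeq T T' -> is_type Γ T' -> typed Γ t T'.
Proof. intros H E [i HT']; eapply typed_conv; eassumption. Qed.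

Lemma is_type_Univ (Γ : list tm) (i : nat) : wf Γ -> is_type Γ (Univ i).
Proof. intros W; exists (S i); now constructor. Qed.

Lemma sort_is_type (n : nat) (Γ : list tm) (A K : tm) (i : nat) :
  typed Γ A K -> sort n K = Some i -> typed Γ A (Univ i).
Proof.
  intros H E; apply (typed_conv_type _ _ _ _ H (sort_sound _ _ _ E)).
  apply is_type_Univ, (typed_wf _ _ _ H).
Qed.

(** Only universes are cumulative in [typed]: a function into [U 0] does not as such have a type of
    functions into [U 1]. An abstraction gets the larger type by retyping its body, where
    [is_type_context_conv] moves the expected codomain to the context of the body. *)
Lemma fits_sound (n : nat) (t : tm) :
  forall Γ T T', infers Γ t T -> is_type Γ T' -> fits n t T T' = true ->
  typed Γ t T'.
Proof.
  assert (G : forall Γ t T T', typed Γ t T -> is_type Γ T' ->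
    match sort n T, sort n T' with
    | Some i, Some j => i <=? j
    | _, _ => equiv n T T'
    end = true -> typed Γ t T').
  { intros Γ u T T' Hu HT' H.
    assert (C : equiv n T T' = true -> typed Γ u T').
    { intros C; apply equiv_sound in C; eapply typed_conv_type; eassumption. }
    destruct (sort n T) as [i|] eqn:Ei; auto.
    destruct (sort n T') as [j|] eqn:Ej; auto.
    apply Nat.leb_le in H; apply sort_sound in Ej.
    apply (typed_conv_type _ _ (Univ j)); auto using defeq_sym.
    apply (typed_cumul_le _ _ i); trivial.
    eapply sort_is_type; eassumption. }
  assert (Q : forall Γ t T T' b, typed Γ t T ->
    (b = true -> typed Γ t T') ->
    (if tm_eqb T T' then true else b) = true -> typed Γ t T').
  { intros Γ u T T' b Hu Hb; destruct (tm_eqb T T') eqn:E; trivial.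
    now apply tm_eqb_eq in E as <-. }
  induction t; intros Γ T T' Ht HT' H; pose proof (infers_typed _ _ _ Ht);
    cbn [fits] in H; (eapply Q; [eassumption| |exact H]); clear H; intros H;
    try (eapply G; eassumption).
  destruct Ht as (B & -> & HA & HB).
  destruct T'; try (eapply G; eassumption).
  apply and_then in H as [H1 H2]; apply equiv_sound in H1.
  pose proof (is_type_Pi_inv _ _ _ HT') as [HA' HB'].
  eapply typed_conv_type; [apply typed_Lam| |eassumption].
  - eapply IHt2; [eassumption| |eassumption].
    eapply is_type_context_conv; eassumption.
  - auto using defeq_Pi, defeq_refl.
Qed.

(** * Soundness of type inference *)

Definition applied (t : tm) (args : list (tm * tm)) : tm :=
  apps t (map fst args).

(** [typed_Const] does not say that the type of a constant is a type. This is verified by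
    computation, one level at a time, whence the bounds. *)
Definition constants_typed (r : nat) : Prop :=
  forall c i j, rank c < r -> i <= level_bound c -> j <= 2 ->
  is_type List.nil (closed (const_type c i j)).

(** The entry at [n] lives over the [length Γ - S n] entries behind it; the bound on [k] says that
    the shift starts beyond all of these. *)
Definition scoped (Γ : list tm) : Prop :=
  forall n A, nth_error Γ n = Some A ->
  forall k, length Γ <= S n + k -> shift k A = A.

(** [scoped] is carried along for abstractions: [typed_Lam] has no premise on the domain, which is
    found instead as the first entry of the context of the body. *)
Lemma typed_scoped :
  (forall Γ t T, typed Γ t T ->
    (forall k, length Γ <= k -> shift k t = t) /\ scoped Γ) /\
  (forall Γ, wf Γ -> scoped Γ).
Proof.
  apply typed_wf_ind; intros; try (intuition; fail).
  - split; trivial; intros k Hk; cbn [shift].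
    assert (n < length Γ) by (apply nth_error_Some; congruence).
    now nat_tests.
  - split; [|apply H]; intros k Hk; simpl; f_equal; [now apply H|].
    apply H0; simpl; lia.
  - destruct H as [Ht H]; split.
    + intros k Hk; simpl; f_equal.
      * apply (H 0); simpl; trivial; lia.
      * apply Ht; simpl; lia.
    + intros n C HC k Hk; apply (H (S n)); simpl; trivial; lia.
  - split; [|apply H]; intros k Hk; simpl; f_equal; [now apply H|now apply H0].
  - now intros [|n] A HA.
  - intros [|n] B HB k Hk; simpl in *.
    + injection HB as <-; apply H; lia.
    + apply (proj2 H n); trivial; lia.
Qed.

Lemma typed_shift_id (t T : tm) (k : nat) : typed List.nil t T -> shift k t = t.
Proof. intros H; apply (proj1 typed_scoped _ _ _ H); apply Nat.le_0_l. Qed.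

Lemma typed_closed (Γ : list tm) (t T : tm) :
  wf Γ -> typed List.nil t T -> is_type List.nil T -> typed Γ t T.
Proof.
  intros W Ht [j HT]; induction Γ as [|A Γ IH]; trivial.
  inversion W as [|? ? i HA]; subst.
  rewrite <- (typed_shift_id _ _ 0 Ht), <- (typed_shift_id _ _ 0 HT).
  apply (typed_shift _ _ _ _ _ HA), IH, (typed_wf _ _ _ HA).
Qed.

Lemma is_type_closed (Γ : list tm) (A : tm) :
  wf Γ -> is_type List.nil A -> is_type Γ A.
Proof.
  intros W [i HA]; exists i; apply typed_closed; trivial.
  apply is_type_Univ; constructor.
Qed.

Definition inferred (Γ : list tm) (u : tm * tm) : Prop :=
  infers Γ (fst u) (snd u) /\ is_type Γ (snd u).

(** Besides typing, [inferred] records that the type is itself a type, because checking an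
    application splits a product by [is_type_Pi_inv]. *)
Lemma infer_sound (r n : nat) :
  constants_typed r ->
  (forall Γ t args T, wf Γ -> Forall (inferred Γ) args ->
    infer r n Γ t args = Some T -> inferred Γ (applied t args, T)) /\
  (forall Γ t args T0 T, wf Γ -> Forall (inferred Γ) args ->
    inferred Γ (t, T0) -> spine r n Γ T0 args = Some T ->
    inferred Γ (applied t args, T)).
Proof.
  intros HC; induction n as [|n (I & J)]; split; try discriminate.
  - intros Γ t args T W Hargs; cbn [infer].
    assert (HT : forall A K i, infer r n Γ A [] = Some K -> sort n K = Some i ->
      typed Γ A (Univ i)).
    { intros A K i E Ei; apply I in E; [|assumption|constructor].
      apply (sort_is_type n _ _ K); trivial; apply infers_typed, E. }
    destruct t as [k|i|A B|A b|f a|c]; intros E.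
    + destruct (nth_error Γ k) as [A|] eqn:Hk; try discriminate.
      rewrite lift_by_lift in E. apply (J _ _ _ _ _ W Hargs) with (2 := E).
      assert (Hv := typed_Var Γ A k W Hk); split; [exact Hv|].
      clear - W Hk; revert Γ W Hk; induction k as [|k IH]; intros [|B Γ] W Hk;
        try discriminate; inversion W as [|? ? i HB]; subst; simpl in Hk |- *.
      * injection Hk as ->. exists i; exact (typed_shift _ _ _ _ _ HB HB).
      * destruct (IH Γ (typed_wf _ _ _ HB) Hk) as [j Hj].
        exists j; exact (typed_shift _ _ _ _ _ HB Hj).
    + apply (J _ _ _ _ _ W Hargs) with (2 := E).
      split; [now constructor|now apply is_type_Univ].
    + destruct (infer r n Γ A []) as [K|] eqn:HA; try discriminate.
      destruct (infer r n (A :: Γ) B []) as [L|] eqn:HB; try discriminate.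
      destruct (sort n K) as [i|] eqn:Hi; try discriminate.
      destruct (sort n L) as [j|] eqn:Hj; try discriminate.
      pose proof (HT _ _ _ HA Hi) as HA'.
      apply (J _ _ _ _ _ W Hargs) with (2 := E).
      split; [|now apply is_type_Univ].
      apply I in HB; [|econstructor; eassumption|constructor].
      pose proof (sort_is_type _ _ _ _ _ (infers_typed _ _ _ (proj1 HB)) Hj).
      apply typed_Pi; eapply typed_cumul_le; try eassumption; lia.
    + destruct (infer r n Γ A []) as [K|] eqn:HA; try discriminate.
      destruct (infer r n (A :: Γ) b []) as [B|] eqn:HB; try discriminate.
      destruct (sort n K) as [i|] eqn:Hi; try discriminate.
      pose proof (HT _ _ _ HA Hi) as HA'.
      apply (J _ _ _ _ _ W Hargs) with (2 := E).
      apply I in HB; [|econstructor; eassumption|constructor].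
      destruct HB as [HB HB'].
      assert (is_type Γ A) by (eexists; eassumption).
      split; [exists B; auto|now apply is_type_Pi].
    + destruct (infer r n Γ a []) as [A|] eqn:HA; try discriminate.
      apply I in HA; [|assumption|constructor].
      apply (I Γ f ((a, A) :: args)); trivial; constructor; assumption.
    + destruct (level_arguments c) as [li lj]; cbv zeta in E.
      destruct (_ && _) eqn:L in E; try discriminate.
      rewrite !andb_true_iff, Nat.ltb_lt, !Nat.leb_le in L.
      destruct L as [[Lr Li] Lj].
      apply (J _ _ _ _ _ W Hargs) with (2 := E).
      split; [now constructor|].
      apply is_type_closed, HC; trivial.
  - intros Γ t args T0 T W Hargs [Ht HT0]; destruct args as [|[u U] args]; cbn [spine].
    { intros E; injection E as <-; split; assumption. }
    inversion Hargs as [|? ? [Hu HU] Hargs']; subst; simpl in Hu, HU.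
    assert (G : forall A B, defeq T0 (Pi A B) -> is_type Γ (Pi A B) ->
      (if fits n u U A then spine r n Γ (inst 0 u B) args else None) = Some T ->
      inferred Γ (applied t ((u, U) :: args), T)).
    { intros A B E HP H; pose proof (is_type_Pi_inv _ _ _ HP) as [HA [j HB]].
      destruct (fits n u U A) eqn:F; try discriminate.
      apply (fits_sound _ _ Γ) in F; trivial.
      apply (J _ (App t u) _ _ _ W Hargs') with (2 := H).
      rewrite inst_subst; split; [|exists j].
      - apply typed_App with A; trivial.
        apply typed_conv_type with T0; trivial; now apply infers_typed.
      - now apply (typed_subst _ A _ (Univ j)). }
    assert (N : match whnf n T0 with
      | Pi A B =>
          match infer r n Γ (Pi A B) [] with
          | Some K =>
              match sort n K with
              | Some _ =>
                  if fits n u U A then spine r n Γ (inst 0 u B) args else None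
              | None => None
              end
          | None => None
          end
      | _ => None
      end = Some T -> inferred Γ (applied t ((u, U) :: args), T)).
    { pose proof (whnf_sound n T0) as E.
      destruct (whnf n T0) as [ | |A B| | | ]; try discriminate.
      destruct (infer r n Γ (Pi A B) []) as [K|] eqn:HP; try discriminate.
      destruct (sort n K) as [i|] eqn:Hi; try discriminate.
      apply G; trivial; exists i.
      apply I in HP; [|assumption|constructor].
      apply (sort_is_type n _ _ K); trivial; apply infers_typed, HP. }
    destruct T0; try exact N. apply G; trivial; apply defeq_refl.
Qed.

Definition checks_type (r n : nat) (Γ : list tm) (A : tm) : bool :=
  match infer r n Γ A [] with
  | Some K => match sort n K with Some _ => true | None => false end
  | None => false
  end.

Lemma checks_type_sound (r n : nat) (Γ : list tm) (A : tm) :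
  constants_typed r -> wf Γ -> checks_type r n Γ A = true -> is_type Γ A.
Proof.
  unfold checks_type; intros HC W H.
  destruct (infer r n Γ A []) as [K|] eqn:E; try discriminate.
  destruct (sort n K) as [i|] eqn:Ei; try discriminate.
  apply (proj1 (infer_sound r n HC)) in E; [|assumption|constructor].
  exists i; eapply sort_is_type; [apply infers_typed, E|eassumption].
Qed.

(** Bootstrapping by rank: once the constants of rank less than [r] are justified, the checker may
    be run on the types of those of rank [r]. Level 2 occurs where [indNat] has a motive with value
    [U 1], as in [IsCycle]. *)
Lemma all_constants_typed : constants_typed 4.
Proof.
  assert (step : forall r, constants_typed r ->
    (forall c, rank c = r -> forallb (fun i => forallb (fun j =>
      checks_type r 100 [] (closed (const_type c i j))) (seq 0 3))
      (seq 0 (S (level_bound c))) = true) ->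
    constants_typed (S r)).
  { intros r HC H c i j Hc Hi Hj.
    destruct (Nat.eq_dec (rank c) r) as [E|E]; [|apply HC; lia].
    specialize (H c E). rewrite forallb_forall in H.
    assert (Li : In i (seq 0 (S (level_bound c)))) by (apply in_seq; lia).
    assert (Lj : In j (seq 0 3)) by (apply in_seq; lia).
    specialize (H i Li); rewrite forallb_forall in H.
    apply (checks_type_sound r 100); auto using wf_nil. }
  do 4 (apply step;
    [|intros c E; destruct c; try discriminate; vm_compute; reflexivity]).
  intros c i j H; lia.
Qed.

(** * Derivations from earlier results *)

Fixpoint closed_at (k : nat) (t : tm) : bool :=
  match t with
  | Var n => n <? k
  | Pi A B | Lam A B => closed_at k A &&& closed_at (S k) B
  | App t u => closed_at k t &&& closed_at k u
  | Univ _ | Const _ => true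
  end.

Lemma subst_closed_at (t : tm) (k : nat) (u : tm) :
  closed_at k t = true -> subst k u t = t.
Proof.
  revert k u; induction t; intros k u H; cbn [closed_at subst] in *;
    try apply and_then in H as [H1 H2]; f_equal; auto.
  apply Nat.ltb_lt in H; now nat_tests.
Qed.

Definition Known (T : exp) : Prop :=
  is_type List.nil (closed T) /\ Derivable T.

Lemma known_wf (hyps : list exp) : Forall Known hyps -> wf (map closed hyps).
Proof.
  induction 1 as [|A hyps [HA _] _ IH]; simpl; [constructor|].
  destruct (is_type_closed _ _ IH HA); econstructor; eassumption.
Qed.

(** Derivations replace the hypotheses one at a time, and the closed [T] survives each substitution.
    The last clause serves the case that [t] is a type, which has to remain the same term. *)
Lemma discharge (hyps : list exp) (t T : tm) :
  Forall Known hyps -> closed_at 0 T = true -> typed (map closed hyps) t T ->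
  exists t', typed List.nil t' T /\ (closed_at 0 t = true -> t' = t).
Proof.
  intros H HT; revert t; induction H as [|A hyps [HA [a Ha]] Hh IH]; intros t Ht.
  - now exists t.
  - apply (typed_closed _ _ _ (known_wf _ Hh)) in Ha; trivial.
    pose proof (typed_subst _ _ _ _ _ Ht Ha) as Ht'.
    rewrite (subst_closed_at T) in Ht' by assumption.
    destruct (IH _ Ht') as (t' & H1 & H2); exists t'; split; trivial.
    intros Hc; rewrite (subst_closed_at t) in H2; auto.
Qed.

Fixpoint binders (hyps : list exp) : Type :=
  match hyps with [] => exp | _ :: hyps => exp -> binders hyps end.

Fixpoint body (d : nat) (hyps : list exp) : binders hyps -> tm :=
  match hyps with
  | [] => fun t => tm_at t d
  | _ :: hyps => fun t => body (S d) hyps (t (evar d))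
  end.

(** The first hypothesis is the outermost variable, so the context lists the hypotheses in
    reverse. *)
Definition derives (n : nat) (hyps : list exp) (T : exp) (t : binders hyps)
    : bool :=
  let t' := body 0 hyps t in
  let T' := closed T in
  match infer 4 n (map closed (rev hyps)) t' [] with
  | Some U =>
      (tm_eqb U T' ||| checks_type 4 n [] T' &&& fits n t' U T')
      &&& closed_at 0 T'
  | None => false
  end.

(** Earlier results enter as variables of their types, so that their proof terms are neither copied
    nor checked again. *)
Lemma derive (n : nat) (hyps : list exp) (T : exp) (t : binders hyps) :
  Forall Known hyps -> derives n hyps T t = true -> Known T.
Proof.
  unfold derives; intros Hh H; apply Forall_rev in Hh.
  pose proof (known_wf _ Hh) as W.
  destruct (infer _ _ _ _ _) as [U|] eqn:E; try discriminate.
  apply (proj1 (infer_sound 4 n all_constants_typed)) in E; trivial.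
  apply and_then in H as [H HT].
  assert (G : typed (map closed (rev hyps)) (body 0 hyps t) (closed T) /\
      is_type (map closed (rev hyps)) (closed T)).
  { apply or_else in H as [H|H].
    - apply tm_eqb_eq in H as <-. split; [apply infers_typed|]; apply E.
    - apply and_then in H as [H1 H2].
      apply (checks_type_sound _ _ _ _ all_constants_typed wf_nil) in H1.
      apply (is_type_closed _ _ W) in H1; split; trivial.
      eapply fits_sound; [apply E|assumption|exact H2]. }
  destruct G as [G [i Hi]]; split.
  - destruct (discharge _ _ (Univ i) Hh eq_refl Hi) as (T' & H1 & H2).
    exists i; now rewrite <- H2.
  - destruct (discharge _ _ _ Hh HT G) as (t' & H1 & _); now exists t'.
Qed.

Create HintDb derivable discriminated.
#[local] Hint Constants Opaque : derivable.

Tactic Notation "derivation" uconstr(hyps) uconstr(t) :=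
  let hyps := constr:(hyps : list exp) in
  apply (derive 1000 hyps _ t);
  [repeat first [apply Forall_nil | apply Forall_cons; [auto with derivable nocore|]]
  |vm_cast_no_check (eq_refl true)].

(** * Sets and univalence *)

Definition sym (A x y p : exp) : exp :=
  J A x (λ y : A, λ _ : Id A x y, Id A y x) (refl A x) y p.
Definition trans (A x y z p q : exp) : exp :=
  J A y (λ z : A, λ _ : Id A y z, Id A x z) p z q.
Definition transport (A : exp) (P : exp -> exp) (x y p u : exp) : exp :=
  J A x (λ y : A, λ _ : Id A x y, P y) u y p.

Definition EquivInjective : exp :=
  Π A : U 1, Π B : U 1, Π f : A ⇒ B, isEquiv A B f ⇒
  Π x : A, Π y : A, Id B (f x) (f y) ⇒ Id A x y.

(** Both [(x, p)] and [(y, refl)] lie in the fiber over [f y], which is contractible. The types are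
    in [U 1] so that [f] may be [idtoeqv], whose domain is an identity type of [U 0]. *)
Lemma equivInjective : Known EquivInjective.
Proof.
  derivation [] (
    λ A : U 1, λ B : U 1, λ f : A ⇒ B, λ e : isEquiv A B f,
    λ x : A, λ y : A, λ p : Id B (f x) (f y),
    let F := fiber A B f (f y) in
    let center := pr1 (isContr F) (e (f y)) in
    let contraction q := pr2 (isContr F) (e (f y)) q in
    let u := pair F x p in
    let v := pair F y (refl B (f y)) in
    ap F A (λ q : F, pr1 F q) u v
      (trans F u center v (sym F center u (contraction u)) (contraction v))).
Qed.
#[local] Hint Resolve equivInjective : derivable.

(** * Function extensionality *)

Definition PointwiseEq : exp :=
  Π A : U 1, Π B : A ⇒ U 1, Π f : (Π x : A, B x), Π g : (Π x : A, B x),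
  (Π x : A, Id (B x) (f x) (g x)) ⇒ Id (Π x : A, B x) f g.

Lemma pointwiseEq : Known PointwiseEq.
Proof.
  derivation [] (
    λ A : U 1, λ B : A ⇒ U 1, λ f : (Π x : A, B x), λ g : (Π x : A, B x),
    λ h : (Π x : A, Id (B x) (f x) (g x)),
    let F := fiber (Id (Π x : A, B x) f g) (Π x : A, Id (B x) (f x) (g x))
      (happly A B f g) h in
    pr1 F (pr1 (isContr F) (econst cFunext A B f g h))).
Qed.
#[local] Hint Resolve pointwiseEq : derivable.

Definition PropPi : exp :=
  Π A : U 1, Π B : A ⇒ U 1, (Π x : A, isProp (B x)) ⇒ isProp (Π x : A, B x).

Lemma propPi : Known PropPi.
Proof.
  derivation [PointwiseEq] (fun pointwiseEq =>
    λ A : U 1, λ B : A ⇒ U 1, λ h : (Π x : A, isProp (B x)),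
    λ f : (Π x : A, B x), λ g : (Π x : A, B x),
    pointwiseEq A B f g (λ x : A, h x (f x) (g x))).
Qed.
#[local] Hint Resolve propPi : derivable.

Definition PropIdPi : exp :=
  Π A : U 1, Π B : A ⇒ U 1, Π f : (Π x : A, B x), Π g : (Π x : A, B x),
  (Π x : A, isProp (Id (B x) (f x) (g x))) ⇒ isProp (Id (Π x : A, B x) f g).

(** [happly] is an equivalence, hence injective. Speaking of two fixed functions, this applies also
    to functions into the universe, where [setPi] does not. *)
Lemma propIdPi : Known PropIdPi.
Proof.
  derivation [EquivInjective; PropPi] (fun equivInjective propPi =>
    λ A : U 1, λ B : A ⇒ U 1, λ f : (Π x : A, B x), λ g : (Π x : A, B x),
    λ h : (Π x : A, isProp (Id (B x) (f x) (g x))),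
    let P := Id (Π x : A, B x) f g in
    λ p : P, λ q : P,
    equivInjective P (Π x : A, Id (B x) (f x) (g x)) (happly A B f g)
      (econst cFunext A B f g) p q
      (propPi A (λ x : A, Id (B x) (f x) (g x)) h
        (happly A B f g p) (happly A B f g q))).
Qed.
#[local] Hint Resolve propIdPi : derivable.

Definition SetPi : exp :=
  Π A : U 1, Π B : A ⇒ U 1, (Π x : A, isSet (B x)) ⇒ isSet (Π x : A, B x).

Lemma setPi : Known SetPi.
Proof.
  derivation [PropIdPi] (fun propIdPi =>
    λ A : U 1, λ B : A ⇒ U 1, λ h : (Π x : A, isSet (B x)),
    λ f : (Π x : A, B x), λ g : (Π x : A, B x),
    propIdPi A B f g (λ x : A, h x (f x) (g x))).
Qed.
#[local] Hint Resolve setPi : derivable.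

(** * Sets recognised by a reflexive relation *)

Definition InverseLeft : exp :=
  Π A : U 1, Π x : A, Π y : A, Π p : Id A x y,
  Id (Id A y y) (trans A y x y (sym A x y p) p) (refl A y).

Lemma inverseLeft : Known InverseLeft.
Proof.
  derivation [] (
    λ A : U 1, λ x : A, λ y : A, λ p : Id A x y,
    J A x (λ y : A, λ p : Id A x y,
        Id (Id A y y) (trans A y x y (sym A x y p) p) (refl A y))
      (refl (Id A x x) (refl A x)) y p).
Qed.
#[local] Hint Resolve inverseLeft : derivable.

Definition SetOfPropRelation : exp :=
  Π A : U 1, Π R : A ⇒ A ⇒ U 1,
  (Π x : A, Π y : A, isProp (R x y)) ⇒ (Π x : A, R x x) ⇒
  (Π x : A, Π y : A, R x y ⇒ Id A x y) ⇒ isSet A.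

(** Any [p] is [f(r)⁻¹ · f(p⁎ r)] by path induction, where [r : R x x], and
    [p⁎ r : R x y] does not depend on [p]. *)
Lemma setOfPropRelation : Known SetOfPropRelation.
Proof.
  derivation [InverseLeft] (fun inverseLeft =>
    λ A : U 1, λ R : A ⇒ A ⇒ U 1,
    λ h : (Π x : A, Π y : A, isProp (R x y)), λ r : (Π x : A, R x x),
    λ f : (Π x : A, Π y : A, R x y ⇒ Id A x y),
    λ x : A, λ y : A, λ p : Id A x y, λ q : Id A x y,
    let path y u := trans A x x y (sym A x x (f x x (r x))) (f x y u) in
    let along y p := transport A (R x) x y p (r x) in
    let eq p :=
      J A x (λ y : A, λ p : Id A x y, Id (Id A x y) (path y (along y p)) p)
        (inverseLeft A x x (f x x (r x))) y p in
    trans (Id A x y) p (path y (along y p)) q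
      (sym (Id A x y) (path y (along y p)) p (eq p))
      (trans (Id A x y) (path y (along y p)) (path y (along y q)) q
        (ap (R x y) (Id A x y) (λ u : R x y, path y u) (along y p) (along y q)
          (h x y (along y p) (along y q)))
        (eq q))).
Qed.
#[local] Hint Resolve setOfPropRelation : derivable.

Definition propOne : exp :=
  λ x : One, λ y : One,
  indOne (λ x : One, Id One x y)
    (indOne (λ y : One, Id One tt y) (refl One tt) y) x.
Definition propZero : exp :=
  λ x : Zero, λ y : Zero, indZero (λ x : Zero, Id Zero x y) x.

Definition SetOfProp : exp := Π A : U 1, isProp A ⇒ isSet A.

(** The criterion for the relation that always holds: in a proposition it implies identity. *)
Lemma setOfProp : Known SetOfProp.
Proof.
  derivation [SetOfPropRelation] (fun setOfPropRelation =>
    λ A : U 1, λ h : isProp A,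
    setOfPropRelation A (λ _ : A, λ _ : A, One)
      (λ _ : A, λ _ : A, propOne) (λ _ : A, tt)
      (λ x : A, λ y : A, λ _ : One, h x y)).
Qed.
#[local] Hint Resolve setOfProp : derivable.

Definition PropIsProp : exp := Π A : U 1, isProp (isProp A).

Lemma propIsProp : Known PropIsProp.
Proof.
  derivation [PropPi; SetOfProp] (fun propPi setOfProp =>
    λ A : U 1, λ f : isProp A, λ g : isProp A,
    propPi A (λ x : A, Π y : A, Id A x y)
      (λ x : A, propPi A (λ y : A, Id A x y) (λ y : A, setOfProp A f x y))
      f g).
Qed.
#[local] Hint Resolve propIsProp : derivable.

Definition PropIsSet : exp := Π A : U 1, isProp (isSet A).

Lemma propIsSet : Known PropIsSet.
Proof.
  derivation [PropPi; PropIsProp] (fun propPi propIsProp =>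
    λ A : U 1,
    propPi A (λ x : A, Π y : A, isProp (Id A x y))
      (λ x : A, propPi A (λ y : A, isProp (Id A x y))
        (λ y : A, propIsProp (Id A x y)))).
Qed.
#[local] Hint Resolve propIsSet : derivable.

Definition SetNat : exp := isSet Nat.

Lemma setNat : Known SetNat.
Proof.
  derivation [SetOfPropRelation] (fun setOfPropRelation =>
    (* Equality of numbers computed by double recursion, with values [One] and [Zero]. *)
    let R m n :=
      indNat (λ _ : Nat, Nat ⇒ U 0)
        (λ n : Nat, indNat (λ _ : Nat, U 0) One (λ _ : Nat, λ _ : U 0, Zero) n)
        (λ _ : Nat, λ r : Nat ⇒ U 0,
         λ n : Nat, indNat (λ _ : Nat, U 0) Zero (λ n : Nat, λ _ : U 0, r n) n)
        m n in
    setOfPropRelation Nat (λ m : Nat, λ n : Nat, R m n)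
      (λ m : Nat, indNat (λ m : Nat, Π n : Nat, isProp (R m n))
        (λ n : Nat, indNat (λ n : Nat, isProp (R zero n)) propOne
          (λ n : Nat, λ _ : isProp (R zero n), propZero) n)
        (λ m : Nat, λ h : (Π n : Nat, isProp (R m n)),
         λ n : Nat, indNat (λ n : Nat, isProp (R (succ m) n)) propZero
          (λ n : Nat, λ _ : isProp (R (succ m) n), h n) n)
        m)
      (λ n : Nat, indNat (λ n : Nat, R n n) tt (λ n : Nat, λ r : R n n, r) n)
      (λ m : Nat, indNat (λ m : Nat, Π n : Nat, R m n ⇒ Id Nat m n)
        (λ n : Nat, indNat (λ n : Nat, R zero n ⇒ Id Nat zero n)
          (λ _ : One, refl Nat zero)
          (λ n : Nat, λ _ : (R zero n ⇒ Id Nat zero n), λ z : Zero,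
            indZero (λ _ : Zero, Id Nat zero (succ n)) z) n)
        (λ m : Nat, λ h : (Π n : Nat, R m n ⇒ Id Nat m n),
         λ n : Nat, indNat (λ n : Nat, R (succ m) n ⇒ Id Nat (succ m) n)
          (λ z : Zero, indZero (λ _ : Zero, Id Nat (succ m) zero) z)
          (λ n : Nat, λ _ : (R (succ m) n ⇒ Id Nat (succ m) n), λ r : R m n,
            ap Nat Nat succ m n (h n r)) n)
        m)).
Qed.
#[local] Hint Resolve setNat : derivable.

Definition SetSum : exp :=
  Π A : U 1, Π B : U 1, isSet A ⇒ isSet B ⇒ isSet (Sum A B).

Lemma setSum : Known SetSum.
Proof.
  derivation [SetOfPropRelation] (fun setOfPropRelation =>
    λ A : U 1, λ B : U 1, λ hA : isSet A, λ hB : isSet B,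
    let S := Sum A B in
    let l := inl A B in
    let r := inr A B in
    (* Identity within a summand, a proposition as the summands are sets, and [Zero] across the
       two. *)
    let R x y :=
      indSum A B (λ _ : S, U 1)
        (λ a : A, indSum A B (λ _ : S, U 1)
          (λ a' : A, Id A a a') (λ _ : B, Zero) y)
        (λ b : B, indSum A B (λ _ : S, U 1)
          (λ _ : A, Zero) (λ b' : B, Id B b b') y)
        x in
    setOfPropRelation S (λ x : S, λ y : S, R x y)
      (λ x : S, λ y : S, indSum A B (λ x : S, isProp (R x y))
        (λ a : A, indSum A B (λ y : S, isProp (R (l a) y))
          (λ a' : A, hA a a') (λ _ : B, propZero) y)
        (λ b : B, indSum A B (λ y : S, isProp (R (r b) y))
          (λ _ : A, propZero) (λ b' : B, hB b b') y)
        x)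
      (λ x : S, indSum A B (λ x : S, R x x) (refl A) (refl B) x)
      (λ x : S, λ y : S, indSum A B (λ x : S, R x y ⇒ Id S x y)
        (λ a : A, indSum A B (λ y : S, R (l a) y ⇒ Id S (l a) y)
          (λ a' : A, ap A S l a a')
          (λ b : B, λ z : Zero, indZero (λ _ : Zero, Id S (l a) (r b)) z) y)
        (λ b : B, indSum A B (λ y : S, R (r b) y ⇒ Id S (r b) y)
          (λ a : A, λ z : Zero, indZero (λ _ : Zero, Id S (r b) (l a)) z)
          (λ b' : B, ap B S r b b') y)
        x)).
Qed.
#[local] Hint Resolve setSum : derivable.

(** A redex for [isSet A], in which [A] occurs only once. *)
Definition IsSet (A : exp) : exp := (λ A : U 1, isSet A) A.

Definition UnfoldIsSet : exp := Π A : U 1, IsSet A ⇒ isSet A.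

Lemma unfoldIsSet : Known UnfoldIsSet.
Proof. derivation [] (λ A : U 1, λ h : IsSet A, h). Qed.
#[local] Hint Resolve unfoldIsSet : derivable.

(** * Paths in dependent sums *)

Definition fst (T : sigma) : exp := λ p : T, pr1 T p.

Definition PathSigma : exp :=
  Π A : U 1, Π B : A ⇒ U 1, (Π x : A, isSet (B x)) ⇒
  let S := Σ x : A, B x in
  Π x : S, Π y : S, Π u : Id S x y, Π v : Id S x y,
  Id (Id A (pr1 S x) (pr1 S y)) (ap S A (fst S) x y u) (ap S A (fst S) x y v) ⇒
  Id (Id S x y) u v.

(** Every [u : (a, b) = y] is rebuilt from its two components, of which the
    second one is a path in a set. *)
Lemma pathSigma : Known PathSigma.
Proof.
  derivation [] (
    λ A : U 1, λ B : A ⇒ U 1, λ h : (Π x : A, isSet (B x)),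
    let S := Σ x : A, B x in
    let π y u := ap S A (fst S) y u in
    λ x : S, indSigma A (famL S)
      (λ x : S, Π y : S, Π u : Id S x y, Π v : Id S x y,
        Id (Id A (pr1 S x) (pr1 S y)) (ap S A (fst S) x y u)
          (ap S A (fst S) x y v) ⇒ Id (Id S x y) u v)
      (λ a : A, λ b : B a, λ y : S,
       let ab := pair S a b in
       let base y u := ap S A (fst S) ab y u in
       let Over y p :=
         Id (B (pr1 S y)) (transport A B a (pr1 S y) p b) (pr2 S y) in
       let over y u :=
         J S ab (λ y : S, λ u : Id S ab y, Over y (base y u)) (refl (B a) b) y u
       in
       let path y p r :=
         indSigma A (famL S)
           (λ y : S, Π p : Id A a (pr1 S y), Over y p ⇒ Id S ab y)
           (λ a' : A, λ b' : B a', λ p : Id A a a',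
             J A a
               (λ a' : A, λ p : Id A a a', Π b' : B a',
                 Id (B a') (transport A B a a' p b) b' ⇒ Id S ab (pair S a' b'))
               (λ b' : B a, λ r : Id (B a) b b',
                 J (B a) b (λ b' : B a, λ _ : Id (B a) b b',
                   Id S ab (pair S a b')) (refl S ab) b' r)
               a' p b')
           y p r in
       let rebuilt u := path y (base y u) (over y u) in
       let eq u :=
         J S ab
           (λ y : S, λ u : Id S ab y,
             Id (Id S ab y) u (path y (base y u) (over y u)))
           (refl (Id S ab ab) (refl S ab)) y u in
       λ u : Id S ab y, λ v : Id S ab y,
       λ k : Id (Id A a (pr1 S y)) (base y u) (base y v),
       trans (Id S ab y) u (rebuilt u) v (eq u)
         (trans (Id S ab y) (rebuilt u) (rebuilt v) v
           (J (Id A a (pr1 S y)) (base y u)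
             (λ p : Id A a (pr1 S y), λ _ : Id (Id A a (pr1 S y)) (base y u) p,
               Π r : Over y p, Id (Id S ab y) (rebuilt u) (path y p r))
             (λ r : Over y (base y u),
               ap (Over y (base y u)) (Id S ab y)
                 (λ r : Over y (base y u), path y (base y u) r) (over y u) r
                 (h (pr1 S y) (transport A B a (pr1 S y) (base y u) b) (pr2 S y)
                   (over y u) r))
             (base y v) k (over y v))
           (sym (Id S ab y) v (rebuilt v) (eq v))))
      x).
Qed.
#[local] Hint Resolve pathSigma : derivable.

Definition SetSigma : exp :=
  Π A : U 1, Π B : A ⇒ U 1, isSet A ⇒ (Π x : A, isSet (B x)) ⇒
  isSet (Σ x : A, B x).

Lemma setSigma : Known SetSigma.
Proof.
  derivation [PathSigma] (fun pathSigma =>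
    λ A : U 1, λ B : A ⇒ U 1,
    λ hA : isSet A, λ hB : (Π x : A, isSet (B x)),
    let S := Σ x : A, B x in
    λ x : S, λ y : S, λ u : Id S x y, λ v : Id S x y,
    pathSigma A B hB x y u v
      (hA (pr1 S x) (pr1 S y) (ap S A (fst S) x y u) (ap S A (fst S) x y v))).
Qed.
#[local] Hint Resolve setSigma : derivable.

Definition PathSubtype : exp :=
  Π A : U 1, Π B : A ⇒ U 1, (Π x : A, isProp (B x)) ⇒
  let S := Σ x : A, B x in
  Π x : S, Π y : S, Id A (pr1 S x) (pr1 S y) ⇒ Id S x y.

Lemma pathSubtype : Known PathSubtype.
Proof.
  derivation [] (
    λ A : U 1, λ B : A ⇒ U 1, λ h : (Π x : A, isProp (B x)),
    let S := Σ x : A, B x in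
    λ x : S, λ y : S,
    indSigma A (famL S) (λ x : S, Id A (pr1 S x) (pr1 S y) ⇒ Id S x y)
      (λ a : A, λ b : B a,
       let ab := pair S a b in
       indSigma A (famL S) (λ y : S, Id A a (pr1 S y) ⇒ Id S ab y)
         (λ a' : A, λ b' : B a', λ p : Id A a a',
           J A a
             (λ a' : A, λ _ : Id A a a', Π b' : B a', Id S ab (pair S a' b'))
             (λ b' : B a, ap (B a) S (λ b : B a, pair S a b) b b' (h a b b'))
             a' p b')
         y)
      x).
Qed.
#[local] Hint Resolve pathSubtype : derivable.

Definition PropIsContr : exp := Π A : U 1, isProp (isContr A).

Lemma propIsContr : Known PropIsContr.
Proof.
  derivation [PathSubtype; PropPi; SetOfProp] (fun pathSubtype propPi setOfProp =>
    λ A : U 1, let C := isContr A in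
    λ u : C, λ v : C,
    let c := pr1 C u in
    let h := λ x : A, λ y : A,
      trans A x c y (sym A c x (pr2 C u x)) (pr2 C u y) in
    pathSubtype A (λ x : A, Π y : A, Id A x y)
      (λ x : A, propPi A (λ y : A, Id A x y) (λ y : A, setOfProp A h x y))
      u v (h c (pr1 C v))).
Qed.
#[local] Hint Resolve propIsContr : derivable.

Definition PropIsEquiv : exp :=
  Π A : U 1, Π B : U 1, Π f : A ⇒ B, isProp (isEquiv A B f).

Lemma propIsEquiv : Known PropIsEquiv.
Proof.
  derivation [PropPi; PropIsContr] (fun propPi propIsContr =>
    λ A : U 1, λ B : U 1, λ f : A ⇒ B,
    propPi B (λ y : B, isContr (fiber A B f y))
      (λ y : B, propIsContr (fiber A B f y))).
Qed.
#[local] Hint Resolve propIsEquiv : derivable.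

(** * Paths in the universe *)

Definition coe (A B p : exp) : exp := pr1 (Equiv A B) (idtoeqv 0 A B p).

Definition PathUniverse : exp :=
  Π A : U 0, Π B : U 0, Π p : Id (U 0) A B, Π q : Id (U 0) A B,
  Id (A ⇒ B) (coe A B p) (coe A B q) ⇒ Id (Id (U 0) A B) p q.

(** This is where univalence is applied: [idtoeqv] is injective, and an equivalence is determined by
    its function. *)
Lemma pathUniverse : Known PathUniverse.
Proof.
  derivation [EquivInjective; PathSubtype; PropIsEquiv]
    (fun equivInjective pathSubtype propIsEquiv =>
    λ A : U 0, λ B : U 0, λ p : Id (U 0) A B, λ q : Id (U 0) A B,
    λ r : Id (A ⇒ B) (coe A B p) (coe A B q),
    equivInjective (Id (U 0) A B) (Equiv A B) (idtoeqv 0 A B)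
      (econst cUnivalence A B) p q
      (pathSubtype (A ⇒ B) (λ f : A ⇒ B, isEquiv A B f)
        (λ f : A ⇒ B, propIsEquiv A B f)
        (idtoeqv 0 A B p) (idtoeqv 0 A B q) r)).
Qed.
#[local] Hint Resolve pathUniverse : derivable.

Definition PropIdUniverse : exp :=
  Π A : U 0, Π B : U 0, isProp B ⇒ isProp (Id (U 0) A B).

Lemma propIdUniverse : Known PropIdUniverse.
Proof.
  derivation [PathUniverse; PointwiseEq] (fun pathUniverse pointwiseEq =>
    λ A : U 0, λ B : U 0, λ h : isProp B,
    λ p : Id (U 0) A B, λ q : Id (U 0) A B,
    pathUniverse A B p q
      (pointwiseEq A (λ _ : A, B) (coe A B p) (coe A B q)
        (λ a : A, h (coe A B p a) (coe A B q a)))).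
Qed.
#[local] Hint Resolve propIdUniverse : derivable.

Definition SetOfPropRelations : exp :=
  Π N : U 0, Π D : (N ⇒ N ⇒ U 0) ⇒ U 1,
  (Π E : N ⇒ N ⇒ U 0, isSet (D E)) ⇒
  (Π E : N ⇒ N ⇒ U 0, D E ⇒ Π x : N, Π y : N, isProp (E x y)) ⇒
  isSet (Σ E : N ⇒ N ⇒ U 0, D E).

(** Relations on [N] do not form a set in general, but [D E] forces [E] to consist of propositions.
    Two paths into a proposition act by functions with values in it, which agree, so paths between
    such relations are unique. *)
Lemma setOfPropRelations : Known SetOfPropRelations.
Proof.
  derivation [PathSigma; PropIdPi; PropIdUniverse]
    (fun pathSigma propIdPi propIdUniverse =>
    λ N : U 0, λ D : (N ⇒ N ⇒ U 0) ⇒ U 1,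
    λ hD : (Π E : N ⇒ N ⇒ U 0, isSet (D E)),
    λ hE : (Π E : N ⇒ N ⇒ U 0, D E ⇒ Π x : N, Π y : N, isProp (E x y)),
    let R := N ⇒ N ⇒ U 0 in
    let S := Σ E : N ⇒ N ⇒ U 0, D E in
    λ x : S, λ y : S, λ u : Id S x y, λ v : Id S x y,
    let E := pr1 S x in
    let E' := pr1 S y in
    pathSigma R D hD x y u v
      (propIdPi N (λ _ : N, N ⇒ U 0) E E'
        (λ a : N, propIdPi N (λ _ : N, U 0) (E a) (E' a)
          (λ b : N, propIdUniverse (E a b) (E' a b) (hE E' (pr2 S y) a b)))
        (ap S R (fst S) x y u) (ap S R (fst S) x y v))).
Qed.
#[local] Hint Resolve setOfPropRelations : derivable.

(** Of a path between labels only the existence is used, so [S] may be a type of families of types,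
    as [Label G] is. *)
Definition Injection (N S : exp) : sigma :=
  Σ g : N ⇒ S, Π a : N, Π b : N, Id S (g a) (g b) ⇒ Id N a b.

Definition SetOfLabelled : exp :=
  Π D : U 0 ⇒ U 1, (Π N : U 0, isSet (D N)) ⇒
  Π S : U 1, (Π N : U 0, D N ⇒ Injection N S) ⇒ isSet (Σ N : U 0, D N).

(** By path induction a path in the sum preserves the labels, which are
    injective: it acts on the types [N] in only one way, and univalence applies. *)
Lemma setOfLabelled : Known SetOfLabelled.
Proof.
  derivation [PathSigma; PathUniverse; PointwiseEq]
    (fun pathSigma pathUniverse pointwiseEq =>
    λ D : U 0 ⇒ U 1, λ hD : (Π N : U 0, isSet (D N)), λ L : U 1,
    λ k : (Π N : U 0, D N ⇒ Injection N L),
    let S := Σ N : U 0, D N in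
    let label x := pr1 (Injection (pr1 S x) L) (k (pr1 S x) (pr2 S x)) in
    let injective x := pr2 (Injection (pr1 S x) L) (k (pr1 S x) (pr2 S x)) in
    let base x y u := ap S (U 0) (fst S) x y u in
    let act x y u := coe (pr1 S x) (pr1 S y) (base x y u) in
    λ x : S, λ y : S, λ u : Id S x y, λ v : Id S x y,
    let preserved u :=
      J S x
        (λ y : S, λ u : Id S x y,
          Π a : pr1 S x, Id L (label y (act x y u a)) (label x a))
        (λ a : pr1 S x, refl L (label x a)) y u in
    pathSigma (U 0) D hD x y u v
      (pathUniverse (pr1 S x) (pr1 S y) (base x y u) (base x y v)
        (pointwiseEq (pr1 S x) (λ _ : pr1 S x, pr1 S y) (act x y u) (act x y v)
          (λ a : pr1 S x, injective y (act x y u a) (act x y v a)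
            (trans L (label y (act x y u a)) (label x a) (label y (act x y v a))
              (preserved u a)
              (sym L (label y (act x y v a)) (label x a) (preserved v a))))))).
Qed.
#[local] Hint Resolve setOfLabelled : derivable.

(** * Cyclic graphs *)

Definition graph_of (N E : exp) : graph := MkGraph N (fun x y => E x y).

Definition ΠRel (k : exp -> exp -> exp) : exp :=
  Π N : U 0, Π E : N ⇒ N ⇒ U 0, k N E.
Definition λRel (k : exp -> exp -> exp) : exp :=
  λ N : U 0, λ E : N ⇒ N ⇒ U 0, k N E.

Definition ΠEndo (k : exp -> exp -> exp -> exp -> exp -> exp) : exp :=
  ΠRel (fun N E => let A := graph_of N E in
    Π s : isGraph A, Π α : HomNodes A A, Π β : HomEdges A A α, k N E s α β).
Definition λEndo (k : exp -> exp -> exp -> exp -> exp -> exp) : exp :=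
  λRel (fun N E => let A := graph_of N E in
    λ s : isGraph A, λ α : HomNodes A A, λ β : HomEdges A A α, k N E s α β).

Definition node_set (G : graph) (s : exp) : exp := pr1 (isGraph G) s.
Definition edge_set (G : graph) (s x y : exp) : exp := pr2 (isGraph G) s x y.

Definition SetIsGraph : exp := ΠRel (fun N E => isSet (isGraph (graph_of N E))).

Lemma setIsGraph : Known SetIsGraph.
Proof.
  derivation [PropIsSet; SetOfProp; SetPi; SetSigma]
    (fun propIsSet setOfProp setPi setSigma =>
    λRel (fun N E =>
      setSigma (isSet N) (λ _ : isSet N, Π x : N, Π y : N, isSet (E x y))
        (setOfProp (isSet N) (propIsSet N))
        (λ _ : isSet N, setPi N (λ x : N, Π y : N, isSet (E x y))
          (λ x : N, setPi N (λ y : N, isSet (E x y))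
            (λ y : N, setOfProp (isSet (E x y)) (propIsSet (E x y))))))).
Qed.
#[local] Hint Resolve setIsGraph : derivable.

Definition SetIsCycle : exp :=
  ΠEndo (fun N E s α β => Π n : Nat, IsSet (IsCycle (graph_of N E) s α β n)).

Definition IsIso (A : graph) (s α β : exp) (C : graph) (rn re : exp) : sigma :=
  Σ p : isGraph C, Id GraphEndo (graphEndo A s α β) (graphEndo C p rn re).

(** [IsCycle] reduces to a truncation only once [n] is zero or a successor, hence the cases. *)
Lemma setIsCycle : Known SetIsCycle.
Proof.
  derivation [SetOfProp] (fun setOfProp =>
    λEndo (fun N E s α β => λ n : Nat,
      let A := graph_of N E in
      let trunc C rn re :=
        let X := IsIso A s α β C rn re in
        setOfProp (Trunc X) (econst cTrPath X) in
      indNat (λ n : Nat, IsSet (IsCycle A s α β n))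
        (trunc cycle0 rot0Nodes rot0Edges)
        (λ m : Nat, λ _ : IsSet (IsCycle A s α β m),
          trunc (cycle (succ m)) (rotNodes (succ m)) (rotEdges (succ m)))
        n)).
Qed.
#[local] Hint Resolve setIsCycle : derivable.

Definition CycleInduction : exp :=
  Π P : GraphEndo ⇒ U 1,
  (Π p : isGraph cycle0, P (graphEndo cycle0 p rot0Nodes rot0Edges)) ⇒
  (Π m : Nat, Π p : isGraph (cycle (succ m)),
    P (graphEndo (cycle (succ m)) p (rotNodes (succ m)) (rotEdges (succ m)))) ⇒
  ΠEndo (fun N E s α β => let A := graph_of N E in
    isProp (P (graphEndo A s α β)) ⇒
    Π n : Nat, IsCycle A s α β n ⇒ P (graphEndo A s α β)).

(** The goal is a proposition, so an identification with a cycle graph is at hand, and [P] is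
    transported back along it. The hypotheses admit every [p], since the identification brings its
    own. *)
Lemma cycleInduction : Known CycleInduction.
Proof.
  derivation [] (
    λ P : GraphEndo ⇒ U 1,
    λ h0 : (Π p : isGraph cycle0, P (graphEndo cycle0 p rot0Nodes rot0Edges)),
    λ hS : (Π m : Nat, Π p : isGraph (cycle (succ m)),
      P (graphEndo (cycle (succ m)) p (rotNodes (succ m)) (rotEdges (succ m)))),
    λEndo (fun N E s α β =>
      let A := graph_of N E in
      let g := graphEndo A s α β in
      λ h : isProp (P g), λ n : Nat,
      let elim C rn re hC c :=
        let X := IsIso A s α β C rn re in
        trRec X (P g) h
          (λ z : X, recSigma X (P g)
            (fun p e => transport GraphEndo P (graphEndo C p rn re) g
              (sym GraphEndo g (graphEndo C p rn re) e) (hC p))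
            z)
          c in
      indNat (λ n : Nat, IsCycle A s α β n ⇒ P g)
        (λ c : IsCycle A s α β zero, elim cycle0 rot0Nodes rot0Edges h0 c)
        (λ m : Nat, λ _ : (IsCycle A s α β m ⇒ P g),
         λ c : IsCycle A s α β (succ m),
          elim (cycle (succ m)) (rotNodes (succ m)) (rotEdges (succ m)) (hS m) c)
        n)).
Qed.
#[local] Hint Resolve cycleInduction : derivable.

Definition predicate_on (P : exp -> exp -> exp) : exp :=
  λ g : GraphEndo, recSigma GraphEndo (U 1)
    (fun N => recSigma (GraphEndo1 N) (U 1) (fun E _ => P N E)) g.

Definition PropEdgesOfCycle : exp :=
  ΠEndo (fun N E s α β => Π n : Nat, IsCycle (graph_of N E) s α β n ⇒
    Π x : N, Π y : N, isProp (E x y)).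

(** An edge of [C_n] for positive [n] is an identification in [Fin n]; that [Fin n] is a set is read
    off from [p]. *)
Lemma propEdgesOfCycle : Known PropEdgesOfCycle.
Proof.
  derivation [CycleInduction; PropPi; PropIsProp]
    (fun cycleInduction propPi propIsProp =>
    λEndo (fun N E s α β =>
      cycleInduction
        (predicate_on (fun N E => Π x : N, Π y : N, isProp (E x y)))
        (λ p : isGraph cycle0, λ x : One, λ y : One, propZero)
        (λ m : Nat, λ p : isGraph (cycle (succ m)),
         λ x : Fin (succ m), λ y : Fin (succ m),
          node_set (cycle (succ m)) p x (finPred (succ m) y))
        N E s α β
        (propPi N (λ x : N, Π y : N, isProp (E x y))
          (λ x : N, propPi N (λ y : N, isProp (E x y))
            (λ y : N, propIsProp (E x y)))))).
Qed.
#[local] Hint Resolve propEdgesOfCycle : derivable.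

Definition Incoming (N E a : exp) : sigma := Σ y : N, E y a.

(** What comparing labels yields directly: an edge into [a] is needed to have an element to compare.
    In this form the claim is uniform in [n] and covers [C_0], which has no edges. *)
Definition Distinguish (N E a b : exp) : exp := Incoming N E a ⇒ Id N a b.

Definition IncomingOfCycle : exp :=
  ΠEndo (fun N E s α β => Π n : Nat, IsCycle (graph_of N E) s α β n ⇒
    Π a : N, Π b : N, Distinguish N E a b ⇒ Id N a b).

(** [C_0] has one node only, and every node of [C_n] for positive [n] has an
    incoming edge. *)
Lemma incomingOfCycle : Known IncomingOfCycle.
Proof.
  derivation [CycleInduction; PropPi] (fun cycleInduction propPi =>
    λEndo (fun N E s α β =>
      cycleInduction
        (predicate_on (fun N E =>
          Π a : N, Π b : N, Distinguish N E a b ⇒ Id N a b))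
        (λ p : isGraph cycle0, λ a : One, λ b : One,
         λ _ : Distinguish One (edgeL cycle0) a b, propOne a b)
        (λ m : Nat, λ p : isGraph (cycle (succ m)),
         let F := Fin (succ m) in
         let E := edgeL (cycle (succ m)) in
         λ a : F, λ b : F, λ h : Distinguish F E a b,
         h (pair (Incoming F E a) (finPred (succ m) a)
            (refl F (finPred (succ m) a))))
        N E s α β
        (propPi N (λ a : N, Π b : N, Distinguish N E a b ⇒ Id N a b)
          (λ a : N, propPi N (λ b : N, Distinguish N E a b ⇒ Id N a b)
            (λ b : N, propPi (Distinguish N E a b)
              (λ _ : Distinguish N E a b, Id N a b)
              (λ _ : Distinguish N E a b,
                node_set (graph_of N E) s a b)))))).
Qed.
#[local] Hint Resolve incomingOfCycle : derivable.

(** * Labels of nodes *)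

Definition Label (G : graph) : exp := TotalEdges (symm G) ⇒ U 0.

Definition total_edge (A : graph) (x y e : exp) : exp :=
  pair (TotalEdges A) x (pair (EdgesFrom A x) y e).

(** The label of a node [a] is the set of images in [symm G] of the edges
    into [a]. *)
Definition label_edge (G A : graph) (α β a t y : exp) : sigma :=
  Σ e : edge A y a,
  Id (TotalEdges (symm G))
    (onTotalEdges A (symm G) α β (total_edge A y a e)) t.
Definition label_at (G A : graph) (α β a t : exp) : sigma :=
  Σ y : node A, label_edge G A α β a t y.
Definition label (G A : graph) (α β : exp) : exp :=
  λ a : node A, λ t : TotalEdges (symm G), label_at G A α β a t.

Definition InjectiveLabel : exp :=
  ΠRel (fun NG EG => let G := graph_of NG EG in
    ΠEndo (fun N E s ρ σ => let A := graph_of N E in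
      Π n : Nat, IsCycle A s ρ σ n ⇒
      Π α : HomNodes A (symm G), Π β : HomEdges A (symm G) α,
      EdgeInjective A (symm G) α β ⇒ Injection N (Label G))).

(** An edge [e] into [a] puts its image [t] in the label of [a], hence in that of [b]: some [e']
    into [b] has the same image. By edge-injectivity the two coincide as total edges, and so do
    their targets. *)
Lemma injectiveLabel : Known InjectiveLabel.
Proof.
  derivation [IncomingOfCycle] (fun incomingOfCycle =>
    λRel (fun NG EG => let G := graph_of NG EG in
    λEndo (fun N E s ρ σ => let A := graph_of N E in
      λ n : Nat, λ c : IsCycle A s ρ σ n,
      λ α : HomNodes A (symm G), λ β : HomEdges A (symm G) α,
      λ i : EdgeInjective A (symm G) α β,
      let TA := TotalEdges A in
      let TG := TotalEdges (symm G) in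
      let h := onTotalEdges A (symm G) α β in
      let injective u v p :=
        let F := fiber (Id TA u v) (Id TG (h u) (h v)) (ap TA TG h u v) p in
        pr1 F (pr1 (isContr F) (i u v p)) in
      let target :=
        λ u : TA, recSigma TA N
          (fun x w => recSigma (EdgesFrom A x) N (fun y _ => y) w) u in
      pair (Injection N (Label G)) (label G A α β)
        (λ a : N, λ b : N,
         λ p : Id (Label G) (label G A α β a) (label G A α β b),
         incomingOfCycle N E s ρ σ n c a b
          (λ w : Incoming N E a, recSigma (Incoming N E a) (Id N a b)
            (fun y e =>
              let u := total_edge A y a e in
              let t := h u in
              let fromA := label_at G A α β a t in
              let fromB := label_at G A α β b t in
              recSigma fromB (Id N a b)
                (fun z w =>
                  recSigma (label_edge G A α β b t z) (Id N a b)
                    (fun e' q =>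
                      let v := total_edge A z b e' in
                      sym N b a (ap TA N target v u (injective v u q)))
                    w)
                (transport (Label G) (fun l => l t)
                  (label G A α β a) (label G A α β b) p
                  (pair fromA y
                    (pair (label_edge G A α β a t y) e (refl TG t)))))
            w))))).
Qed.
#[local] Hint Resolve injectiveLabel : derivable.

(** * Faces and maps *)

Definition SetStar : exp :=
  ΠRel (fun N E => let G := graph_of N E in
    isGraph G ⇒ Π x : N, isSet (Star G x)).

Lemma setStar : Known SetStar.
Proof.
  derivation [SetSigma; SetSum] (fun setSigma setSum =>
    λRel (fun N E => let G := graph_of N E in
      λ s : isGraph G, λ x : N,
      setSigma N (λ y : N, edge (symm G) x y) (node_set G s)
        (λ y : N, setSum (E x y) (E y x) (edge_set G s x y) (edge_set G s y x)))).
Qed.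
#[local] Hint Resolve setStar : derivable.

Definition SetMap : exp :=
  ΠRel (fun N E => let G := graph_of N E in isGraph G ⇒ IsSet (Map G)).

Lemma setMap : Known SetMap.
Proof.
  derivation [SetStar; SetPi; SetSigma; SetNat; SetOfProp]
    (fun setStar setPi setSigma setNat setOfProp =>
    λRel (fun N E => let G := graph_of N E in
      λ s : isGraph G,
      setPi N (λ x : N, Cyclic (Star G x))
        (λ x : N,
         let X := sigma_type (Star G x) in
         setSigma (X ⇒ X) (λ φ : X ⇒ X, CyclicWith X φ)
          (setPi X (λ _ : X, X) (λ _ : X, setStar N E s x))
          (λ φ : X ⇒ X,
           let T n :=
             Σ e : Equiv X (Fin n),
             let f := pr1 (Equiv X (Fin n)) e in
             Id (X ⇒ Fin n) (λ x : X, f (φ x)) (λ x : X, finPred n (f x)) in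
           setSigma Nat (λ n : Nat, Trunc (T n)) setNat
            (λ n : Nat, setOfProp (Trunc (T n)) (econst cTrPath (T n))))))).
Qed.
#[local] Hint Resolve setMap : derivable.

Definition SetHomEdges : exp :=
  ΠRel (fun N E => ΠRel (fun N' E' => Π α : N ⇒ N',
    (Π x : N', Π y : N', isSet (E' x y)) ⇒
    isSet (HomEdges (graph_of N E) (graph_of N' E') α))).

Lemma setHomEdges : Known SetHomEdges.
Proof.
  derivation [SetPi] (fun setPi =>
    λRel (fun N E => λRel (fun N' E' => λ α : N ⇒ N',
    λ h : (Π x : N', Π y : N', isSet (E' x y)),
    let T x y := E x y ⇒ E' (α x) (α y) in
    setPi N (λ x : N, Π y : N, T x y)
      (λ x : N, setPi N (λ y : N, T x y)
        (λ y : N, setPi (E x y) (λ _ : E x y, E' (α x) (α y))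
          (λ _ : E x y, h (α x) (α y))))))).
Qed.
#[local] Hint Resolve setHomEdges : derivable.

Definition SetIsFace : exp :=
  ΠRel (fun NG EG => let G := graph_of NG EG in
    isGraph G ⇒ Π M : Map G, ΠRel (fun N E => let A := graph_of N E in
    Π pred : N ⇒ N, Π suc : N ⇒ N, Π n : Nat,
    Π α : HomNodes A (symm G), Π β : HomEdges A (symm G) α,
    IsSet (IsFace G M (MkCyclic A pred suc n) α β))).

(** Being an embedding is a proposition, star-compatibility has truncated values, and a corner
    condition is a path in a star, which is a set. *)
Lemma setIsFace : Known SetIsFace.
Proof.
  derivation [SetStar; SetPi; SetSigma; SetOfProp; PropIsEquiv]
    (fun setStar setPi setSigma setOfProp propIsEquiv =>
    λRel (fun NG EG => let G := graph_of NG EG in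
      λ s : isGraph G, λ M : Map G, λRel (fun N E => let A := graph_of N E in
      λ pred : N ⇒ N, λ suc : N ⇒ N, λ n : Nat,
      λ α : HomNodes A (symm G), λ β : HomEdges A (symm G) α,
      let TA := TotalEdges A in
      let TG := TotalEdges (symm G) in
      let h := onTotalEdges A (symm G) α β in
      let star x := Star G (α x) in
      let embeds x y :=
        isEquiv (Id TA x y) (Id TG (h x) (h y)) (ap TA TG h x y) in
      let starCompatible x := Trunc (star x) ⇒ Trunc (Star A x) in
      let left x a :=
        rotate G M (α x)
          (pair (star x) (α (pred x)) (flip G (α (pred x)) (α x) (β (pred x) x a)))
      in
      let right x a' := pair (star x) (α (suc x)) (β x (suc x) a') in
      let corner x a a' := Id (star x) (left x a) (right x a') in
      let corners x := Π a : E (pred x) x, Π a' : E x (suc x), corner x a a' in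
      setSigma (Π x : TA, Π y : TA, embeds x y)
        (λ _ : (Π x : TA, Π y : TA, embeds x y),
          (Π x : N, starCompatible x) × (Π x : N, corners x))
        (setPi TA (λ x : TA, Π y : TA, embeds x y)
          (λ x : TA, setPi TA (λ y : TA, embeds x y)
            (λ y : TA, setOfProp (embeds x y)
              (propIsEquiv (Id TA x y) (Id TG (h x) (h y)) (ap TA TG h x y)))))
        (λ _ : (Π x : TA, Π y : TA, embeds x y),
          setSigma (Π x : N, starCompatible x)
            (λ _ : (Π x : N, starCompatible x), Π x : N, corners x)
            (setPi N (λ x : N, starCompatible x)
              (λ x : N, setPi (Trunc (star x))
                (λ _ : Trunc (star x), Trunc (Star A x))
                (λ _ : Trunc (star x),
                  setOfProp (Trunc (Star A x)) (econst cTrPath (Star A x)))))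
            (λ _ : (Π x : N, starCompatible x),
              setPi N (λ x : N, corners x)
                (λ x : N, setPi (E (pred x) x)
                  (λ a : E (pred x) x, Π a' : E x (suc x), corner x a a')
                  (λ a : E (pred x) x, setPi (E x (suc x))
                    (λ a' : E x (suc x), corner x a a')
                    (λ a' : E x (suc x), setOfProp (corner x a a')
                      (setStar NG EG s (α x)
                        (left x a) (right x a')))))))))).
Qed.
#[local] Hint Resolve setIsFace : derivable.

(** * The type of faces *)

Section FaceComponents.

(** The components of a face, in which [Cycle N E s α β n] and
    [Hom N E α suc n h k] stand for the last condition on a cyclic graph and for
    the conditions on a homomorphism; leaving them abstract keeps terms small. *)
Context (G : graph) (Cycle Hom : exp).

Definition FaceHomEdges (N E α suc n h : exp) : sigma :=
  Σ k : HomEdges (graph_of N E) (symm G) h, Hom N E α suc n h k.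
Definition FaceHom (N E α suc n : exp) : sigma :=
  Σ h : HomNodes (graph_of N E) (symm G), FaceHomEdges N E α suc n h.
Definition FaceRight (N E α suc n : exp) : sigma :=
  (Π x : N, Id N (α (suc x)) x) × FaceHom N E α suc n.
Definition FaceLeft (N E α suc n : exp) : sigma :=
  (Π x : N, Id N (suc (α x)) x) × FaceRight N E α suc n.
Definition FaceSuc (N E α n : exp) : sigma :=
  Σ suc : N ⇒ N, FaceLeft N E α suc n.
Definition FaceCycle (N E s α β n : exp) : sigma :=
  Cycle N E s α β n × FaceSuc N E α n.
Definition FaceSize (N E s α β : exp) : sigma :=
  Σ n : Nat, FaceCycle N E s α β n.
Definition FaceEndoEdges (N E s α : exp) : sigma :=
  Σ β : HomEdges (graph_of N E) (graph_of N E) α, FaceSize N E s α β.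
Definition FaceEndo (N E s : exp) : sigma :=
  Σ α : HomNodes (graph_of N E) (graph_of N E), FaceEndoEdges N E s α.
Definition FaceGraph (N E : exp) : sigma :=
  Σ s : isGraph (graph_of N E), FaceEndo N E s.
Definition FaceEdges (N : exp) : sigma := Σ E : N ⇒ N ⇒ U 0, FaceGraph N E.
Definition FaceNodes : sigma := Σ N : U 0, FaceEdges N.

Definition recFaceGraph (N E C : exp)
    (f : exp -> exp -> exp -> exp -> exp -> exp -> exp) (d : exp) : exp :=
  recSigma (FaceGraph N E) C (fun s => recSigma (FaceEndo N E s) C (fun α =>
    recSigma (FaceEndoEdges N E s α) C (fun β =>
      recSigma (FaceSize N E s α β) C (fun n =>
        recSigma (FaceCycle N E s α β n) C (f s α β n))))) d.

Definition recFaceSuc (N E α n C : exp)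
    (f : exp -> exp -> exp -> exp -> exp) (d : exp) : exp :=
  recSigma (FaceSuc N E α n) C (fun suc =>
    recSigma (FaceLeft N E α suc n) C (fun _ =>
      recSigma (FaceRight N E α suc n) C (fun _ =>
        recSigma (FaceHom N E α suc n) C (fun h =>
          recSigma (FaceHomEdges N E α suc n h) C (f suc h))))) d.

Definition CycleCondition : exp := ΠEndo (fun N E s α β => Nat ⇒ U 1).
Definition ΠHom (k : exp -> exp -> exp -> exp -> exp -> exp -> exp -> exp) : exp :=
  ΠRel (fun N E => let A := graph_of N E in
    Π α : N ⇒ N, Π suc : N ⇒ N, Π n : Nat,
    Π h : HomNodes A (symm G), Π l : HomEdges A (symm G) h, k N E α suc n h l).
Definition HomCondition : exp := ΠHom (fun _ _ _ _ _ _ _ => U 1).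

Definition CycleSet : exp :=
  ΠEndo (fun N E s α β => Π n : Nat, IsSet (Cycle N E s α β n)).
Definition HomSet : exp :=
  ΠHom (fun N E α suc n h k => IsSet (Hom N E α suc n h k)).
Definition CycleProp : exp :=
  ΠEndo (fun N E s α β => Π n : Nat, Cycle N E s α β n ⇒
    Π x : N, Π y : N, isProp (E x y)).
Definition Labelling (L : exp) : exp :=
  ΠEndo (fun N E s α β => let A := graph_of N E in
    Π n : Nat, Cycle N E s α β n ⇒ Π suc : N ⇒ N,
    Π h : HomNodes A (symm G), Π k : HomEdges A (symm G) h,
    Hom N E α suc n h k ⇒ Injection N L).

End FaceComponents.

Definition SetFaceNodes : exp :=
  ΠRel (fun NG EG => let G := graph_of NG EG in
    isGraph G ⇒ Π C : CycleCondition, Π H : HomCondition G, Π L : U 1,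
    CycleSet C ⇒ HomSet G H ⇒ CycleProp C ⇒ Labelling G C H L ⇒
    IsSet (FaceNodes G C H)).

(** Only [N] and [E] involve the universe and call for [setOfLabelled] and [setOfPropRelations];
    everything nested inside is collected by [setSigma]. *)
Lemma setFaceNodes : Known SetFaceNodes.
Proof.
  derivation [SetPi; SetSigma; SetSum; SetNat; SetOfProp; SetIsGraph; SetHomEdges;
      SetOfLabelled; SetOfPropRelations]
    (fun setPi setSigma setSum setNat setOfProp setIsGraph setHomEdges
       setOfLabelled setOfPropRelations =>
    λRel (fun NG EG => let G := graph_of NG EG in
      λ sG : isGraph G, λ C : CycleCondition, λ H : HomCondition G, λ L : U 1,
      λ setC : CycleSet C, λ setH : HomSet G H, λ propC : CycleProp C,
      λ labelling : Labelling G C H L,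
      let setHom N E α suc n :=
        let A := graph_of N E in
        setSigma (HomNodes A (symm G))
          (λ h : HomNodes A (symm G), FaceHomEdges G H N E α suc n h)
          (setPi N (λ _ : N, NG) (λ _ : N, node_set G sG))
          (λ h : HomNodes A (symm G), setSigma (HomEdges A (symm G) h)
            (λ k : HomEdges A (symm G) h, H N E α suc n h k)
            (setHomEdges N E NG (edgeL (symm G)) h
              (λ x : NG, λ y : NG, setSum (EG x y) (EG y x)
                (edge_set G sG x y) (edge_set G sG y x)))
            (setH N E α suc n h)) in
      let setSuc N E s α n :=
        let nodes := node_set (graph_of N E) s in
        let setInverse f :=
          setPi N (λ x : N, Id N (f x) x)
            (λ x : N, setOfProp (Id N (f x) x) (nodes (f x) x)) in
        setSigma (N ⇒ N) (λ suc : N ⇒ N, FaceLeft G H N E α suc n)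
          (setPi N (λ _ : N, N) (λ _ : N, nodes))
          (λ suc : N ⇒ N,
           let left x := suc (α x) in
           let right x := α (suc x) in
           setSigma (Π x : N, Id N (left x) x)
            (λ _ : (Π x : N, Id N (left x) x), FaceRight G H N E α suc n)
            (setInverse left)
            (λ _ : (Π x : N, Id N (left x) x),
              setSigma (Π x : N, Id N (right x) x)
                (λ _ : (Π x : N, Id N (right x) x), FaceHom G H N E α suc n)
                (setInverse right)
                (λ _ : (Π x : N, Id N (right x) x), setHom N E α suc n))) in
      let setGraph N E :=
        let A := graph_of N E in
        setSigma (isGraph A) (λ s : isGraph A, FaceEndo G C H N E s)
          (setIsGraph N E)
          (λ s : isGraph A, setSigma (N ⇒ N)
            (λ α : N ⇒ N, FaceEndoEdges G C H N E s α)
            (setPi N (λ _ : N, N) (λ _ : N, node_set A s))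
            (λ α : N ⇒ N, setSigma (HomEdges A A α)
              (λ β : HomEdges A A α, FaceSize G C H N E s α β)
              (setHomEdges N E N E α (pr2 (isGraph A) s))
              (λ β : HomEdges A A α, setSigma Nat
                (λ n : Nat, FaceCycle G C H N E s α β n) setNat
                (λ n : Nat, setSigma (C N E s α β n)
                  (λ _ : C N E s α β n, FaceSuc G H N E α n)
                  (setC N E s α β n)
                  (λ _ : C N E s α β n, setSuc N E s α n))))) in
      let propEdges N E :=
        λ d : FaceGraph G C H N E,
        recFaceGraph G C H N E (Π x : N, Π y : N, isProp (E x y))
          (fun s α β n c _ => propC N E s α β n c) d in
      let labels N :=
        λ d : FaceEdges G C H N,
        recSigma (FaceEdges G C H N) (Injection N L) (fun E =>
          recFaceGraph G C H N E (Injection N L) (fun s α β n c =>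
            recFaceSuc G H N E α n (Injection N L) (fun suc h k f =>
              labelling N E s α β n c suc h k f))) d in
      setOfLabelled (λ N : U 0, FaceEdges G C H N)
        (λ N : U 0, setOfPropRelations N
          (λ E : N ⇒ N ⇒ U 0, FaceGraph G C H N E)
          (λ E : N ⇒ N ⇒ U 0, setGraph N E)
          (λ E : N ⇒ N ⇒ U 0, propEdges N E))
        L (λ N : U 0, labels N))).
Qed.
#[local] Hint Resolve setFaceNodes : derivable.

Definition IsCycleCondition : exp :=
  λEndo (fun N E s α β => λ n : Nat, IsCycle (graph_of N E) s α β n).
Definition IsFaceCondition (G : graph) (M : exp) : exp :=
  λRel (fun N E => let A := graph_of N E in
    λ pred : N ⇒ N, λ suc : N ⇒ N, λ n : Nat,
    λ h : HomNodes A (symm G), λ k : HomEdges A (symm G) h,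
    IsFace G M (MkCyclic A pred suc n) h k).

Definition SetFace : exp :=
  ΠRel (fun NG EG => let G := graph_of NG EG in
    isGraph G ⇒ Π M : Map G, IsSet (Face G M)).

(** [FaceNodes] nests its components in the order of [ΣCyclic], so that for the conditions given
    here it reduces to [Face G M]. *)
Lemma setFace : Known SetFace.
Proof.
  derivation [SetFaceNodes; SetIsCycle; SetIsFace; PropEdgesOfCycle; InjectiveLabel]
    (fun setFaceNodes setIsCycle setIsFace propEdgesOfCycle injectiveLabel =>
    λRel (fun NG EG => let G := graph_of NG EG in
      λ sG : isGraph G, λ M : Map G,
      setFaceNodes NG EG sG IsCycleCondition (IsFaceCondition G M) (Label G)
        setIsCycle (setIsFace NG EG sG M) propEdgesOfCycle
        (λEndo (fun N E s α β =>
          let A := graph_of N E in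
          λ n : Nat, λ c : IsCycle A s α β n, λ suc : N ⇒ N,
          λ h : HomNodes A (symm G), λ k : HomEdges A (symm G) h,
          let F := IsFace G M (MkCyclic A α suc n) h k in
          λ f : F, injectiveLabel NG EG N E s α β n c h k (pr1 F f))))).
Qed.
#[local] Hint Resolve setFace : derivable.

(** * Planar maps *)

Definition SetPlanar : exp :=
  Π X : U 1, Π N : U 1, Π W : N ⇒ N ⇒ U 1,
  Π H : X ⇒ Π x : N, Π y : N, W x y ⇒ W x y ⇒ U 1, Π F : X ⇒ U 1,
  IsSet X ⇒ (Π M : X, IsSet (F M)) ⇒
  IsSet (Σ M : X, (Π x : N, Π y : N, Π w : W x y, Π w' : W x y,
    Trunc (H M x y w w')) × F M).

(** Homotopies occur under a truncation, so sphericity is a proposition for any [H]. Keeping maps,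
    walks, homotopies and faces abstract spares the checker their unfolding. *)
Lemma setPlanar : Known SetPlanar.
Proof.
  derivation [SetPi; SetSigma; SetOfProp] (fun setPi setSigma setOfProp =>
    λ X : U 1, λ N : U 1, λ W : N ⇒ N ⇒ U 1,
    λ H : X ⇒ Π x : N, Π y : N, W x y ⇒ W x y ⇒ U 1, λ F : X ⇒ U 1,
    λ hX : IsSet X, λ hF : (Π M : X, IsSet (F M)),
    let T M x y w w' := Trunc (H M x y w w') in
    let S M := Π x : N, Π y : N, Π w : W x y, Π w' : W x y, T M x y w w' in
    setSigma X (λ M : X, S M × F M) hX
      (λ M : X, setSigma (S M) (λ _ : S M, F M)
        (setPi N (λ x : N, Π y : N, Π w : W x y, Π w' : W x y, T M x y w w')
          (λ x : N, setPi N (λ y : N, Π w : W x y, Π w' : W x y, T M x y w w')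
            (λ y : N, setPi (W x y) (λ w : W x y, Π w' : W x y, T M x y w w')
              (λ w : W x y, setPi (W x y) (λ w' : W x y, T M x y w w')
                (λ w' : W x y, setOfProp (T M x y w w')
                  (econst cTrPath (H M x y w w')))))))
        (λ _ : S M, hF M))).
Qed.
#[local] Hint Resolve setPlanar : derivable.

Theorem theorem5p6 :
  Derivable
    (ΠGraph (fun G =>
      Connected G ⇒ FiniteGraph G ⇒ isSet (Planar G))).
Proof.
  refine (proj2 (_ : Known _)).
  derivation [SetPlanar; SetMap; SetFace; UnfoldIsSet]
    (fun setPlanar setMap setFace unfoldIsSet =>
    λRel (fun N E => let G := graph_of N E in
      let W x y := WalkIn (symm G) x y in
      λ s : isGraph G, λ _ : Connected G, λ _ : FiniteGraph G,
      unfoldIsSet (Planar G)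
        (setPlanar (Map G) N (λ x : N, λ y : N, W x y)
          (λ M : Map G, λ x : N, λ y : N, λ w : W x y, λ w' : W x y,
            Homotopy G M x y w w')
          (λ M : Map G, Face G M) (setMap N E s) (setFace N E s)))).
Qed.
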